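(* Let $X$ be a pervasive Archimedean pre-Riesz space equipped with an order continuous regular norm $\|\cdot\|_X$, and let $(X^\delta,i)$ be the Dedekind completion of $X$, equipped with \[\|y\|_{X^\delta}:=\inf\{\|x\|_X\colon\, x\in X \text{ such that } -i(x)\le y\le i(x)\},\qquad y\in X^\delta.\] Let $Y$ be a Banach lattice with an order continuous norm. Let $T\in L(X,Y)$ be a positive compact operator and assume that $(X^\delta)'$ has an order continuous norm. If $S\in L(X,Y)$ satisfies $0\le S\le T$, then $S$ is compact.
   Context: All spaces are real. A partially ordered vector space $X$ is Archimedean if $x,y\in X$ and $nx\le y$ for all $n\in\mathbb{N}$ imply $x\le 0$. For a finite set $M\subset X$, $M^{\mathrm u}$ denotes its set of upper bounds. $X$ is a pre-Riesz space if for all $x,y,z\in X$ the inclusion $\{x+y,x+z\}^{\mathrm u}\subseteq\{y,z\}^{\mathrm u}$ implies $x\ge 0$. A linear map $i$ is bipositive if $x\ge 0\iff i(x)\ge 0$. A subspace $D$ of $Z$ is order dense in $Z$ if $z=\inf\{d\in D\colon d\ge z\}$ for every $z\in Z$. The Riesz completion $(X^\rho,i_\rho)$ of a pre-Riesz space $X$ is the (essentially unique) vector lattice $X^\rho$ with a bipositive linear map $i_\rho\colon X\to X^\rho$ such that $i_\rho(X)$ is order dense in $X^\rho$ and generates $X^\rho$ as a vector lattice. $X$ is pervasive if for every $y\in X^\rho$ with $y>0$ there is $x\in X$ with $0<i_\rho(x)\le y$. The Dedekind completion $(X^\delta,i)$ of an Archimedean pre-Riesz space $X$ is the (essentially unique)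 Dedekind complete vector lattice $X^\delta$ with a bipositive linear map $i\colon X\to X^\delta$ such that $i(X)$ is order dense in $X^\delta$. A net $(x_\alpha)$ order converges to $x$ if there is a net $(y_\beta)$ with $y_\beta\downarrow 0$ such that for every $\beta$ there is $\alpha_0$ with $\pm(x_\alpha-x)\le y_\beta$ for all $\alpha\ge\alpha_0$. A norm is order continuous if $\|x_\alpha-x\|\to 0$ whenever $(x_\alpha)$ order converges to $x$. A norm on $X$ is regular if $\|x\|=\inf\{\|y\|\colon y\in X,\ -y\le x\le y\}$ for all $x\in X$. $L(X,Y)$ denotes the bounded linear operators from $X$ to $Y$; $0\le S\le T$ means $0\le Sx\le Tx$ for all $x\in X$ with $x\ge 0$. An operator is compact if it maps every norm bounded sequence to a sequence with a norm convergent subsequence. $(X^\delta)'$ is the topological dual of $(X^\delta,\|\cdot\|_{X^\delta})$, with the dual norm and the dual order. *)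

(* Defs.v *)
From HB Require Import structures.
From mathcomp Require Import all_boot all_order all_algebra.
From mathcomp Require Import all_classical all_reals all_analysis.

Set Implicit Arguments.
Unset Strict Implicit.
Unset Printing Implicit Defensive.
Import Order.TTheory GRing.Theory Num.Theory.
Import numFieldNormedType.Exports.
Local Open Scope classical_set_scope.
Local Open Scope ring_scope.

HB.mixin Record Lmodule_isOrdered (R : realType) V
    of GRing.Lmodule R V & Num.POrderedZmodule V := {
  levD2r : forall z x y : V, x <= y -> x + z <= y + z;
  lev_wpscale : forall (a : R) (x y : V), 0 <= a -> x <= y -> a *: x <= a *: y
}.

#[short(type="orderedLmodType")]
HB.structure Definition OrderedLmodule (R : realType) :=
  {V of GRing.Lmodule R V & Num.POrderedZmodule V & Lmodule_isOrdered R V}.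

(* [Order.Lattice] and [normedModType] are not reused on top of
   [orderedLmodType]: Hierarchy Builder rejects such joins because [numDomainType]
   and [realDomainType] already inherit from both sides.  Hence the operations
   below, and norms given as functions p : V -> R. *)
HB.mixin Record OrderedLmodule_isVectorLattice (R : realType) V
    of OrderedLmodule R V := {
  vjoin : V -> V -> V;
  vmeet : V -> V -> V;
  vjoin_le : forall x y z : V, (vjoin x y <= z) = (x <= z) && (y <= z);
  le_vmeet : forall x y z : V, (z <= vmeet x y) = (z <= x) && (z <= y)
}.

#[short(type="vectorLatticeType")]
HB.structure Definition VectorLattice (R : realType) :=
  {V of OrderedLmodule R V & OrderedLmodule_isVectorLattice R V}.

Section OrderedSpaces.
Context {R : realType}.

(* n.+1, as the natural numbers start at 1 here; starting at 0 would add the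
   hypothesis 0 <= y, which makes no difference in a directed space. *)
Definition archimedean_space (X : orderedLmodType R) : Prop :=
  forall x y : X, (forall n : nat, x *+ n.+1 <= y) -> x <= 0.

Definition pre_Riesz (X : orderedLmodType R) : Prop :=
  forall x y z : X,
    ubound [set x + y; x + z] `<=` ubound [set y; z] -> 0 <= x.

Definition bipositive (X Z : orderedLmodType R) (i : X -> Z) : Prop :=
  forall x : X, 0 <= x <-> 0 <= i x.

Definition order_dense (Z : orderedLmodType R) (D : set Z) : Prop :=
  forall z : Z, infimums [set d | D d /\ z <= d] z.

Record vector_sublattice (Z : vectorLatticeType R) (W : set Z) : Prop := {
  vector_sublattice0 : W 0;
  vector_sublatticeD : forall x y, W x -> W y -> W (x + y);
  vector_sublatticeZ : forall (a : R) x, W x -> W (a *: x);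
  vector_sublattice_meet : forall x y, W x -> W y -> W (vmeet x y);
  vector_sublattice_join : forall x y, W x -> W y -> W (vjoin x y)
}.

Definition generates_lattice (Z : vectorLatticeType R) (D : set Z) : Prop :=
  forall W : set Z, vector_sublattice W -> D `<=` W -> W = setT.

Record Riesz_completion (X : orderedLmodType R) (Z : vectorLatticeType R)
    (i : {linear X -> Z}) : Prop := {
  Riesz_completion_bipositive : bipositive i;
  Riesz_completion_dense : order_dense (range i);
  Riesz_completion_generates : generates_lattice (range i)
}.

(* The Riesz completion is unique up to isomorphism, hence the choice of the
   completion (Z, i) is immaterial. *)
Definition pervasive (X : orderedLmodType R) : Prop :=
  exists (Z : vectorLatticeType R) (i : {linear X -> Z}),
    Riesz_completion i /\
    forall y : Z, 0 < y -> exists x : X, 0 < i x <= y.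

Definition Dedekind_complete (Z : vectorLatticeType R) : Prop :=
  forall A : set Z, A !=set0 -> has_ubound A -> supremums A !=set0.

Record Dedekind_completion (X : orderedLmodType R) (Z : vectorLatticeType R)
    (i : {linear X -> Z}) : Prop := {
  Dedekind_completion_complete : Dedekind_complete Z;
  Dedekind_completion_bipositive : bipositive i;
  Dedekind_completion_dense : order_dense (range i)
}.

Record directed (A : Type) (leA : A -> A -> Prop) : Prop := {
  directed_inhabited : inhabited A;
  directed_refl : forall a, leA a a;
  directed_trans : forall a b c, leA a b -> leA b c -> leA a c;
  directed_ub : forall a b, exists c, leA a c /\ leA b c
}.

Definition decreases_to0 (V : orderedLmodType R) (B : Type)
    (leB : B -> B -> Prop) (y : B -> V) : Prop :=
  (forall b b', leB b b' -> y b' <= y b) /\ infimums (range y) 0.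

Definition order_cvg (V : orderedLmodType R) (A : Type)
    (leA : A -> A -> Prop) (x : A -> V) (l : V) : Prop :=
  exists (B : Type) (leB : B -> B -> Prop) (y : B -> V),
    [/\ directed leB, decreases_to0 leB y &
      forall b, exists a0, forall a, leA a0 a ->
        x a - l <= y b /\ - (x a - l) <= y b].

Definition order_continuous_norm (V : orderedLmodType R) (p : V -> R) : Prop :=
  forall (A : Type) (leA : A -> A -> Prop) (x : A -> V) (l : V),
    directed leA -> order_cvg leA x l ->
    forall e : R, 0 < e -> exists a0, forall a, leA a0 a -> p (x a - l) < e.

Record is_norm (V : lmodType R) (p : V -> R) : Prop := {
  is_norm_eq0 : forall x, p x = 0 -> x = 0;
  is_normZ : forall (a : R) x, p (a *: x) = `|a| * p x;
  is_normD : forall x y, p (x + y) <= p x + p y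
}.

(* As [inf set0 = 0], the condition fails, as it should, at every x != 0 for
   which no y satisfies -y <= x <= y. *)
Definition regular_norm (X : orderedLmodType R) (p : X -> R) : Prop :=
  forall x : X, p x = inf [set p y | y in [set y : X | - y <= x <= y]].

(* The set is never empty when i is the Dedekind completion of a pre-Riesz
   space. *)
Definition delta_norm (X Z : orderedLmodType R) (p : X -> R) (i : X -> Z)
    (y : Z) : R :=
  inf [set p x | x in [set x : X | - i x <= y <= i x]].

Definition norm_cvg (V : lmodType R) (p : V -> R) (u : nat -> V) (l : V)
  : Prop := (fun n => p (u n - l)) @ \oo --> (0 : R).

Definition norm_complete (V : lmodType R) (p : V -> R) : Prop :=
  forall u : nat -> V,
    (forall e : R, 0 < e -> exists N : nat, forall m n : nat,
       (N <= m)%N -> (N <= n)%N -> p (u m - u n) < e) ->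
    exists l, norm_cvg p u l.

Definition labs (V : vectorLatticeType R) (x : V) : V := vjoin x (- x).

Record Banach_lattice (Y : vectorLatticeType R) (q : Y -> R) : Prop := {
  Banach_lattice_norm : is_norm q;
  Banach_lattice_monotone : forall x y, labs x <= labs y -> q x <= q y;
  Banach_lattice_complete : norm_complete q
}.

Definition bounded_map (U W : Type) (p : U -> R) (q : W -> R) (f : U -> W)
  : Prop := exists C : R, forall x, q (f x) <= C * p x.

Definition compact_map (U W : lmodType R) (p : U -> R) (q : W -> R)
    (f : U -> W) : Prop :=
  forall u : nat -> U, (exists M : R, forall n, p (u n) <= M) ->
    exists phi : nat -> nat, {homo phi : m n / (m < n)%N} /\
      exists l, norm_cvg q (fun n => f (u (phi n))) l.

Definition op_le (X Y : orderedLmodType R) (S T : X -> Y) : Prop :=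
  forall x : X, 0 <= x -> S x <= T x.

Definition positive_operator (X Y : orderedLmodType R) (T : X -> Y) : Prop :=
  op_le (fun _ => 0) T.

End OrderedSpaces.

Section Dual.
Context {R : realType} {V : vectorLatticeType R} (p : V -> R).

Definition dual_pred : {pred V -> R^o} :=
  [pred f | `[< linear f /\ bounded_map p (fun t : R => `|t|) f >]].

Fact dual_submod_closed : submod_closed dual_pred.
Proof.
split; first apply/asboolP.
  split; first by move=> a x y; rewrite /= scaler0 addr0.
  by exists 0 => x; rewrite normr0 mul0r.
move=> a f g /asboolP[lf [C hC]] /asboolP[lg [D hD]]; apply/asboolP; split.
  move=> b x y; have E z : (a *: f + g) z = a * f z + g z by [].
  rewrite !E (lf b x y) (lg b x y) /GRing.scale /=.
  by rewrite !mulrDr addrACA !mulrA [a * b]mulrC.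
exists (`|a| * C + D) => x; rewrite mulrDl -mulrA.
apply: (le_trans (ler_normD _ _)); apply: lerD (hD x).
by rewrite normrM ler_wpM2l.
Qed.

HB.instance Definition _ :=
  GRing.isSubmodClosed.Build R (V -> R^o) dual_pred dual_submod_closed.

(* The topological dual of (V, p): linear functionals bounded with respect to
   the norm p. *)
Record dual := Dual { dual_fun :> V -> R^o; _ : dual_fun \in dual_pred }.

HB.instance Definition _ := [isSub for dual_fun].
HB.instance Definition _ := [Choice of dual by <:].
HB.instance Definition _ := [SubChoice_isSubLmodule of dual by <:].

Definition dual_le (f g : dual) : bool :=
  `[< forall x : V, 0 <= x -> (f x : R) <= g x >].

Fact dual_le_refl : reflexive dual_le.
Proof. by move=> f; apply/asboolP. Qed.

Fact dual_le_trans : transitive dual_le.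
Proof.
move=> g f h /asboolP fg /asboolP gh; apply/asboolP => x x0.
exact: le_trans (fg x x0) (gh x x0).
Qed.

Fact dual_le_anti : antisymmetric dual_le.
Proof.
move=> f g /andP[/asboolP fg /asboolP gf]; apply/val_inj/funext => x /=.
have eqp z : 0 <= z -> f z = g z.
  by move=> z0; apply: le_anti; rewrite (fg z z0) (gf z z0).
have [/asboolP[lf _] /asboolP[lg _]] := (valP f, valP g).
set u : V := vjoin x 0.
have /andP[xu u0] : (x <= u) && (0 <= u) by rewrite -vjoin_le.
have ux : 0 <= u - x by rewrite -(subrr x); exact: levD2r.
have xE : x = (-1) *: (u - x) + u by rewrite scaleN1r opprB subrK.
rewrite xE; move: (lf (-1) (u - x) u) (lg (-1) (u - x) u) => -> ->.
by rewrite /= (eqp _ ux) (eqp _ u0).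
Qed.

HB.instance Definition _ := Order.Le_isPOrder.Build ring_display dual
  dual_le_refl dual_le_anti dual_le_trans.

Fact dual_levD2r (h f g : dual) : f <= g -> f + h <= g + h.
Proof.
by move=> /asboolP fg; apply/asboolP => x x0; rewrite lerD2r fg.
Qed.

Fact dual_lev_wpscale (a : R) (f g : dual) :
  0 <= a -> f <= g -> a *: f <= a *: g.
Proof.
move=> a0 /asboolP fg; apply/asboolP => x x0.
by apply: ler_wpM2l => //; exact: fg.
Qed.

HB.instance Definition _ :=
  Lmodule_isOrdered.Build R dual dual_levD2r dual_lev_wpscale.

Definition dual_norm (f : dual) : R :=
  sup [set `|f x : R| | x in [set x : V | p x <= 1]].

End Dual.
Arguments dual {R V} p.
Arguments dual_norm {R V} p f.

(* Main.v *)
Require Import Defs.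
From HB Require Import structures.
From mathcomp Require Import all_boot all_order all_algebra.
From mathcomp Require Import all_classical all_reals all_analysis.
From mathcomp Require Import ring lra.
Set Implicit Arguments.
Unset Strict Implicit.
Unset Printing Implicit Defensive.
Import Order.TTheory GRing.Theory Num.Theory.
Import numFieldNormedType.Exports.
Local Open Scope classical_set_scope.
Local Open Scope ring_scope.

(** Let [E] be the Dedekind completion of [X] with the norm [N] induced by that of
    [X], and let [F] be the target lattice. The theorem follows from the
    Dodds-Fremlin theorem on [E], once [S] and [T] have been extended to [E].

    Extension. The image of [X] is norm dense in [E]. Since [X] is pervasive, a
    maximal directed set of elements of [X] between [0] and a positive [y] in [E]
    has supremum [y] (lemma [directed_approximation]). Doing this for [y] and for
    [i u - y], where [i u] majorizes [y], gives a net in [X] that decreases to zero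
    and bounds the distance from [y] to [X]; the norm of [X] being order
    continuous, the norms of its terms tend to zero ([positive_approximation]). As
    [F] is complete, [S] and [T] extend to bounded operators on [E]. Positive
    elements have positive approximants, hence the extensions still satisfy
    [0 <= S <= T], and [T] still maps balls to totally bounded sets.

    Domination on [E]. Three facts are combined in [Dodds_Fremlin].

    - As the dual norm is order continuous, for every bounded positive functional
      [f] on [E] and [e > 0] there is [x >= 0] such that [f] is at most [e] at the
      positive part of [z - x], for all positive [z] in the unit ball
      ([almost_order_bounded]). This is applied to [f = g \o T], where the
      functional [g] almost computes the norm on the image of the positive ball
      ([image_of_ball_dominated]). It follows that [S z] is close to
      [S (vmeet z x)], so that only the order interval from [0] to [x] matters.

    - As the norm of [F] is order continuous, on an order interval of [F] it is
      dominated, up to [e], by a single positive functional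
      ([seminorm_dominated]).

    - In the seminorm that a positive functional [g] defines on [F], [S] maps the
      order interval to a totally bounded set because [T] does
      ([dominated_interval]). The pair [(T, g)] behaves like a measure on a product
      space, with [(S, g)] as a smaller measure. As in the proof of the
      Radon-Nikodym theorem by orthogonal projection, a grid that almost maximizes
      the energy, the sum of the terms [s ^+ 2 / t] over the masses of its cells,
      exhibits [S] as almost a multiple of [T] on each cell. So [S] inherits total
      boundedness from [T] with an error as small as desired.

    The first two facts are proved by the same gliding hump argument, once with
    functionals carried by ideals of [E] and once with suprema in [F]. *)


(** * Ordered vector spaces *)

Section OrderedModules.
Context {R : realType} {V : orderedLmodType R}.
Implicit Types (x y z t : V) (a b : R).

Lemma levD2rE z x y : (x + z <= y + z) = (x <= y).
Proof.
apply/idP/idP => [|xy]; last exact: levD2r.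
by move=> /(levD2r (- z)); rewrite !addrK.
Qed.

Lemma levD2lE z x y : (z + x <= z + y) = (x <= y).
Proof. by rewrite ![z + _]addrC levD2rE. Qed.

Lemma levD x y z t : x <= y -> z <= t -> x + z <= y + t.
Proof.
by move=> xy zt; apply: (@le_trans _ _ (y + z)); rewrite ?levD2rE ?levD2lE.
Qed.

Lemma addv_ge0 x y : 0 <= x -> 0 <= y -> 0 <= x + y.
Proof. by move=> x0 y0; rewrite -[0]addr0 levD. Qed.

Lemma levBlDr x y z : (x - y <= z) = (x <= z + y).
Proof. by rewrite -[LHS](levD2rE y) subrK. Qed.

Lemma levBrDr x y z : (x <= y - z) = (x + z <= y).
Proof. by rewrite -[LHS](levD2rE z) subrK. Qed.

Lemma levBlDl x y z : (x - y <= z) = (x <= y + z).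
Proof. by rewrite levBlDr addrC. Qed.

Lemma levBrDl x y z : (x <= y - z) = (z + x <= y).
Proof. by rewrite levBrDr addrC. Qed.

Lemma subv_ge0 x y : (0 <= y - x) = (x <= y).
Proof. by rewrite levBrDr add0r. Qed.

Lemma levN2 x y : (- x <= - y) = (y <= x).
Proof. by rewrite -[LHS]subv_ge0 opprK addrC subv_ge0. Qed.

Lemma oppv_le0 x : (- x <= 0) = (0 <= x).
Proof. by rewrite -[LHS]levN2 opprK oppr0. Qed.

Lemma oppv_ge0 x : (0 <= - x) = (x <= 0).
Proof. by rewrite -[LHS]levN2 opprK oppr0. Qed.

Lemma scalev_ge0 a x : 0 <= a -> 0 <= x -> 0 <= a *: x.
Proof. by move=> a0 x0; rewrite -(scaler0 _ a) lev_wpscale. Qed.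

Lemma levZ2r a b x : 0 <= x -> a <= b -> a *: x <= b *: x.
Proof. by move=> x0 ab; rewrite -subv_ge0 -scalerBl scalev_ge0 ?subr_ge0. Qed.

Lemma levZ2l a x y : 0 < a -> (a *: x <= a *: y) = (x <= y).
Proof.
move=> a0; apply/idP/idP => [|xy]; last by rewrite lev_wpscale// ltW.
have ai : 0 <= a^-1 by rewrite invr_ge0 ltW.
by move=> /(lev_wpscale _ _ _ ai); rewrite !scalerA mulVf ?gt_eqF// !scale1r.
Qed.

Lemma sumv_ge0 (I : Type) (s : seq I) (f : I -> V) :
  (forall i, 0 <= f i) -> 0 <= \sum_(i <- s) f i.
Proof. by move=> f0; elim/big_rec: _ => // i x _ x0; exact: addv_ge0. Qed.

End OrderedModules.

(** * Vector lattices *)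

Section VectorLattices.
Context {R : realType} {V : vectorLatticeType R}.
Implicit Types (x y z : V) (a b : R).

Lemma vjoinl x y : x <= vjoin x y.
Proof. by have := lexx (vjoin x y); rewrite vjoin_le => /andP[]. Qed.

Lemma vjoinr x y : y <= vjoin x y.
Proof. by have := lexx (vjoin x y); rewrite vjoin_le => /andP[]. Qed.

Lemma vmeetl x y : vmeet x y <= x.
Proof. by have := lexx (vmeet x y); rewrite le_vmeet => /andP[]. Qed.

Lemma vmeetr x y : vmeet x y <= y.
Proof. by have := lexx (vmeet x y); rewrite le_vmeet => /andP[]. Qed.

Definition vpos x : V := vjoin x 0.

Lemma vpos_ge0 x : 0 <= vpos x. Proof. exact: vjoinr. Qed.

Lemma vpos_ge x : x <= vpos x. Proof. exact: vjoinl. Qed.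

Lemma vpos_le x y : (vpos x <= y) = (x <= y) && (0 <= y).
Proof. by rewrite vjoin_le. Qed.

Lemma vpos_mono x y : x <= y -> vpos x <= vpos y.
Proof. by move=> xy; rewrite vpos_le vpos_ge0 (le_trans xy) ?vpos_ge. Qed.

Lemma vpos_id x : 0 <= x -> vpos x = x.
Proof. by move=> x0; apply: le_anti; rewrite vpos_ge vpos_le lexx x0. Qed.

Lemma vposN x : vpos (- x) = vpos x - x.
Proof.
apply: le_anti; apply/andP; split.
  by rewrite vpos_le subv_ge0 vpos_ge andbT -[leLHS]add0r levD2rE vpos_ge0.
rewrite levBlDr vpos_le; apply/andP; split.
  by rewrite -[leLHS]add0r levD2rE vpos_ge0.
by rewrite -levBlDr sub0r vpos_ge.
Qed.

Lemma vposBN x : x = vpos x - vpos (- x).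
Proof. by rewrite vposN opprB addrCA subrr addr0. Qed.

(** Scaling [d] down by [1 + b] puts it below both the positive and the negative
    part of [x], whose infimum is zero. *)
Lemma vpos_disjoint b d x : 0 <= b -> d <= b *: vpos x -> d <= vpos (- x) ->
  d <= 0.
Proof.
move=> b0 dp dn; have b1 : 0 < 1 + b by rewrite ltr_pwDl.
rewrite -(levZ2l _ _ (_ : 0 < (1 + b)^-1)) ?invr_gt0// scaler0.
set e := (1 + b)^-1 *: d.
have le1 c w : 0 <= w -> d <= c *: w -> c <= 1 + b -> e <= w.
  move=> w0 dw cb; rewrite -(levZ2l _ _ b1) scalerA mulfV ?gt_eqF// scale1r.
  exact: le_trans dw (levZ2r w0 cb).
have ep : e <= vpos x by apply: (le1 b) => //; rewrite ?vpos_ge0// lerDr.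
have en : e <= vpos (- x).
  by apply: (le1 1); rewrite ?vpos_ge0 ?scale1r// lerDl.
suff : vpos (- x) <= vpos (- x) - e.
  by rewrite -[leLHS]addr0 levD2lE oppv_ge0.
by rewrite vpos_le subv_ge0 en andbT vposN addrAC -[leLHS]add0r levD2rE subv_ge0.
Qed.

Lemma labsE x : labs x = vpos x + vpos (- x).
Proof.
apply: le_anti; rewrite vjoin_le; apply/andP; split.
  rewrite -[X in X <= _]addr0 levD ?vpos_ge ?vpos_ge0//=.
  by rewrite -[X in X <= _]add0r levD ?vpos_ge ?vpos_ge0.
have l0 : 0 <= labs x.
  rewrite -(levZ2l _ _ (_ : 0 < 2%R :> R))// scaler0 scaler_nat mulr2n.
  by rewrite -(subrr x) levD ?vjoinl ?vjoinr.
have h0 : 0 <= 2^-1 :> R by rewrite invr_ge0.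
have hh : 2^-1 + 2^-1 = 1 :> R by lra.
have -> : labs x = 2^-1 *: (labs x + x) + 2^-1 *: (labs x + x) - x.
  by rewrite -scalerDl hh scale1r addrK.
have le_h : vpos x <= 2^-1 *: (labs x + x).
  rewrite vpos_le; apply/andP; split.
    rewrite -(levZ2l _ _ (_ : 0 < 2%R :> R))// scalerA mulfV// scale1r.
    by rewrite scaler_nat mulr2n levD2rE vjoinl.
  by rewrite scalev_ge0// -(subrr x) addrC levD2rE vjoinr.
by rewrite vposN addrA levD2rE levD.
Qed.

Lemma labs_ge0 x : 0 <= labs x.
Proof. by rewrite labsE addv_ge0 ?vpos_ge0. Qed.

Lemma labs_id x : 0 <= x -> labs x = x.
Proof.
by move=> x0; rewrite labsE vposN vpos_id// subrr addr0.
Qed.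

Lemma labs_le x y : (labs x <= y) = (- y <= x <= y).
Proof. by rewrite vjoin_le andbC -[- x <= y]levN2 opprK. Qed.

Lemma labsN x : labs (- x) = labs x.
Proof. by rewrite !labsE opprK addrC. Qed.

Lemma labsZ a x : labs (a *: x) = `|a| *: labs x.
Proof.
wlog a0 : a x / 0 <= a => [hw|].
  case: (leP 0 a) => [/hw //|/ltW a0].
  by rewrite -[a *: x]opprK -scaleNr labsN hw ?oppr_ge0// normrN.
have le_Z b y : 0 <= b -> labs (b *: y) <= b *: labs y.
  move=> b0; rewrite labs_le -scalerN !lev_wpscale// ?vjoinl//.
  by rewrite -levN2 opprK vjoinr.
rewrite ger0_norm//; apply: le_anti; rewrite le_Z//=.
have [->|an0] := eqVneq a 0; first by rewrite scale0r labs_ge0.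
have ap : 0 < a by rewrite lt_def an0.
have := le_Z a^-1 (a *: x); rewrite scalerA mulVf// scale1r invr_ge0 => /(_ a0).
by move=> /(lev_wpscale _ _ _ a0); rewrite scalerA mulfV// scale1r.
Qed.

Lemma labs_triangle x y : labs (x + y) <= labs x + labs y.
Proof.
by rewrite labs_le opprD !levD ?vjoinl// -levN2 opprK vjoinr.
Qed.

Lemma vmeetB x y : x - vmeet x y = vpos (x - y).
Proof.
apply: le_anti; apply/andP; split; last first.
  by rewrite vpos_le levD2lE levN2 vmeetr subv_ge0 vmeetl.
rewrite levBlDr -levBlDl le_vmeet levBlDr -levBlDl subrr vpos_ge0 /=.
by rewrite levBlDr -levBlDl vpos_ge.
Qed.

(** The part of [z] below [x] is [vmeet z x], and what remains of [z] is the
    positive part of [z - x], hence below [y]. *)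
Lemma Riesz_decomposition z x y : 0 <= x -> 0 <= y -> 0 <= z <= x + y ->
  exists2 a, 0 <= a <= x & 0 <= z - a <= y.
Proof.
move=> x0 y0 /andP[z0 zxy]; exists (vmeet z x).
  by rewrite le_vmeet z0 x0 vmeetr.
by rewrite subv_ge0 vmeetl vmeetB vpos_le levBlDl zxy y0.
Qed.

(** The indices have to be distinct, as the pieces are given as a function of the
    index. *)
Lemma Riesz_decomposition_sum (I : eqType) (s : seq I) (f : I -> V) z :
  uniq s -> (forall i, 0 <= f i) -> 0 <= z <= \sum_(i <- s) f i ->
  exists2 g : I -> V, forall i, 0 <= g i <= f i & \sum_(i <- s) g i = z.
Proof.
move=> + f0; elim: s z => [|i s IHs] z /=.
  move=> _; rewrite big_nil => /le_anti <-.
  by exists (fun=> 0); rewrite ?big_nil// => i; rewrite lexx f0.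
rewrite big_cons => /andP[ins us] zle.
have [a a_le /(IHs _ us)[g g_le gs]] :=
  Riesz_decomposition (f0 i) (sumv_ge0 s f0) zle.
exists (fun j => if j == i then a else g j).
  by move=> j; case: eqP => [->//|_].
rewrite big_cons eqxx -[z](subrK a) addrC -gs; congr (_ + _).
by rewrite !big_seq; apply: eq_bigr => j js; case: eqP js ins => // -> ->.
Qed.

End VectorLattices.

(** * Lattice seminorms *)

Section LatticeSeminorms.
Context {R : realType} {V : vectorLatticeType R}.
Implicit Types (x y z : V) (a b : R).

Record lattice_seminorm (N : V -> R) : Prop := {
  seminormZ : forall a x, N (a *: x) = `|a| * N x;
  seminormD : forall x y, N (x + y) <= N x + N y;
  seminorm_mono : forall x y, labs x <= labs y -> N x <= N y
}.

Context (N : V -> R) (hN : lattice_seminorm N).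

Lemma seminorm0 : N 0 = 0.
Proof. by rewrite -(scale0r 0) seminormZ// normr0 mul0r. Qed.

Lemma seminormN x : N (- x) = N x.
Proof. by rewrite -scaleN1r seminormZ// normrN1 mul1r. Qed.

Lemma seminorm_ge0 x : 0 <= N x.
Proof.
by have := seminormD hN x (- x); rewrite subrr seminorm0 seminormN; lra.
Qed.

Lemma seminormBC x y : N (x - y) = N (y - x).
Proof. by rewrite -seminormN opprB. Qed.

Lemma seminormB_le x y z : N (x - y) <= N (x - z) + N (z - y).
Proof.
by have -> : x - y = (x - z) + (z - y) by [rewrite addrA subrK]; exact: seminormD.
Qed.

Lemma seminorm_le x y : 0 <= x <= y -> N x <= N y.
Proof.
move=> /andP[x0 xy]; apply: seminorm_mono => //.
by rewrite !labs_id// (le_trans x0).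
Qed.

Lemma seminorm_labs x : N (labs x) = N x.
Proof.
by apply: le_anti; rewrite !(seminorm_mono hN)// [labs (labs x)]labs_id ?labs_ge0.
Qed.

Lemma seminorm_vpos x : N (vpos x) <= N x.
Proof.
rewrite -[leRHS]seminorm_labs seminorm_le// vpos_ge0 labsE.
by rewrite -[leLHS]addr0 levD2lE vpos_ge0.
Qed.

End LatticeSeminorms.

(** * Positive functionals and their components *)

Section PositiveFunctionals.
Context {R : realType} {V : vectorLatticeType R}.
Implicit Types (x y z w : V) (a b : R).

Record positive_functional (f : V -> R) : Prop := {
  functional_linear : forall a x y, f (a *: x + y) = a * f x + f y;
  functional_ge0 : forall x, 0 <= x -> 0 <= f x
}.

Section Theory.
Context (f : V -> R) (hf : positive_functional f).

Lemma functionalD x y : f (x + y) = f x + f y.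
Proof. by rewrite -{1}[x]scale1r functional_linear// mul1r. Qed.

Lemma functional0 : f 0 = 0.
Proof. by have := functionalD 0 0; rewrite addr0; lra. Qed.

Lemma functionalZ a x : f (a *: x) = a * f x.
Proof. by rewrite -[a *: x]addr0 functional_linear// functional0 addr0. Qed.

Lemma functionalN x : f (- x) = - f x.
Proof. by rewrite -scaleN1r functionalZ mulN1r. Qed.

Lemma functionalB x y : f (x - y) = f x - f y.
Proof. by rewrite functionalD functionalN. Qed.

Lemma functional_sum (I : Type) (s : seq I) (x : I -> V) :
  f (\sum_(i <- s) x i) = \sum_(i <- s) f (x i).
Proof. exact: (big_morph f functionalD functional0). Qed.

Lemma functional_le x y : x <= y -> f x <= f y.
Proof. by rewrite -subv_ge0 => /(functional_ge0 hf); rewrite functionalB subr_ge0. Qed.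

Lemma functional_norm x : `|f x| <= f (labs x).
Proof.
by rewrite ler_norml -functionalN !functional_le// ?vjoinl// -levN2 opprK vjoinr.
Qed.

End Theory.

(** The unique candidate for a linear extension of [f] from the positive cone. *)
Definition cone_ext (f : V -> R) x : R := f (vpos x) - f (vpos (- x)).

Section ConeExtension.
Context (f : V -> R).
Hypothesis fD : forall x y, 0 <= x -> 0 <= y -> f (x + y) = f x + f y.
Hypothesis fZ : forall a x, 0 <= a -> 0 <= x -> f (a *: x) = a * f x.
Hypothesis f0 : forall x, 0 <= x -> 0 <= f x.

Lemma cone_extB x y : 0 <= x -> 0 <= y -> cone_ext f (x - y) = f x - f y.
Proof.
move=> x0 y0; set d := x - y.
have : f (vpos d + y) = f (x + vpos (- d)).
  by rewrite vposN {3}/d opprB [x + _]addrCA [x + _]addrC subrK.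
by rewrite !fD ?vpos_ge0// /cone_ext; lra.
Qed.

Lemma cone_ext_pos x : 0 <= x -> cone_ext f x = f x.
Proof.
move=> x0; rewrite -{1}[x]subr0 cone_extB//.
by have := fZ (lexx 0) (lexx 0); rewrite scale0r mul0r => ->; rewrite subr0.
Qed.

Lemma cone_ext_functional : positive_functional (cone_ext f).
Proof.
split=> [a x y|x x0]; last by rewrite cone_ext_pos// f0.
have extD u v : cone_ext f (u + v) = cone_ext f u + cone_ext f v.
  rewrite {1}(vposBN u) {1}(vposBN v) addrACA -opprD cone_extB ?addv_ge0 ?vpos_ge0//.
  by rewrite !fD ?vpos_ge0// /cone_ext; lra.
rewrite extD; congr (_ + _); case: (leP 0 a) => [a0|/ltW a0].
  rewrite {1}(vposBN x) scalerBr cone_extB ?scalev_ge0 ?vpos_ge0//.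
  by rewrite !fZ ?vpos_ge0// -mulrBr.
have -> : a *: x = (- a) *: vpos (- x) - (- a) *: vpos x.
  by rewrite -scalerBr scaleNr -scalerN opprB -vposBN.
rewrite cone_extB ?scalev_ge0 ?oppr_ge0 ?vpos_ge0//.
by rewrite !fZ ?oppr_ge0 ?vpos_ge0// /cone_ext; lra.
Qed.

End ConeExtension.

Record positive_ideal (D : set V) : Prop := {
  ideal0 : D 0;
  ideal_ge0 : forall w, D w -> 0 <= w;
  idealD : forall v w, D v -> D w -> D (v + w);
  idealZ : forall a w, 0 <= a -> D w -> D (a *: w);
  ideal_solid : forall v w, 0 <= v <= w -> D w -> D v
}.

(** The part of [g] that is carried by the ideal with positive cone [D]. It plays
    the role of [g] composed with the band projection onto the band generated by
    [D], but it exists in every vector lattice. *)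
Definition component (g : V -> R) (D : set V) : V -> R :=
  cone_ext (fun z => sup [set g w | w in [set w | D w /\ w <= z]]).

Section Component.
Context (g : V -> R) (D : set V).
Hypotheses (hg : positive_functional g) (hD : positive_ideal D).

Let below z := [set g w | w in [set w | D w /\ w <= z]].

Let below_sup z : 0 <= z -> has_sup (below z).
Proof.
move=> z0; split; first by exists (g 0), 0 => //; split=> //; exact: ideal0.
by exists (g z) => _ [w [_ wz] <-]; exact: functional_le.
Qed.

Let le_below z w : 0 <= z -> D w -> w <= z -> g w <= sup (below z).
Proof. by move=> z0 Dw wz; apply: ub_le_sup; [case: (below_sup z0)|exists w]. Qed.

Let below_le z c : 0 <= z -> (forall w, D w -> w <= z -> g w <= c) ->
  sup (below z) <= c.
Proof.
move=> z0 h; apply: ge_sup; first by case: (below_sup z0).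
by move=> _ [w [Dw wz] <-]; exact: h.
Qed.

(* Additivity of the supremum is the Riesz decomposition of the elements of [D];
   solidity keeps both pieces in [D]. *)
Let belowD x y : 0 <= x -> 0 <= y -> sup (below (x + y)) = sup (below x) + sup (below y).
Proof.
move=> x0 y0; have xy0 := addv_ge0 x0 y0; apply: le_anti; apply/andP; split.
  apply: below_le => // w Dw wxy.
  have w0 := ideal_ge0 hD Dw.
  have [|u ux /andP[wu0 wuy]] := Riesz_decomposition (z := w) x0 y0; first by rewrite w0.
  have /andP[u0 ulex] := ux.
  rewrite -[w](subrK u) addrC functionalD// lerD// le_below//.
    by apply: (ideal_solid hD) Dw; rewrite u0 -subv_ge0.
  apply: (ideal_solid hD) Dw; rewrite wu0 -[leRHS]addr0 levD2lE.
  by rewrite oppv_le0.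
rewrite -lerBrDr; apply: below_le => // u Du ux.
rewrite lerBrDr addrC -lerBrDr; apply: below_le => // v Dv vy.
rewrite lerBrDr addrC -functionalD// le_below ?levD//; exact: idealD.
Qed.

Let belowZ a x : 0 <= a -> 0 <= x -> sup (below (a *: x)) = a * sup (below x).
Proof.
have le_Z b y : 0 < b -> 0 <= y -> b * sup (below y) <= sup (below (b *: y)).
  move=> b0 y0; rewrite -ler_pdivlMl//; apply: below_le => // w Dw wy.
  rewrite ler_pdivlMl// -functionalZ// le_below ?scalev_ge0 ?(ltW b0)//.
    by apply: idealZ => //; exact: ltW.
  by rewrite levZ2l.
rewrite le_eqVlt => /predU1P[<- x0|a0 x0].
  rewrite scale0r mul0r; apply: le_anti; apply/andP; split.
    by apply: below_le => // w _ w0; rewrite -(functional0 hg) functional_le.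
  by rewrite -[leLHS](functional0 hg) le_below//; exact: ideal0.
apply: le_anti; rewrite le_Z// andbT -ler_pdivrMl//.
have := le_Z a^-1 (a *: x); rewrite invr_gt0 scalev_ge0 ?(ltW a0)//.
by rewrite scalerA mulVf ?gt_eqF// scale1r; exact.
Qed.

Let below_ge0 x : 0 <= x -> 0 <= sup (below x).
Proof. by move=> x0; rewrite -(functional0 hg) le_below//; exact: ideal0. Qed.

Lemma component_functional : positive_functional (component g D).
Proof. exact: cone_ext_functional belowD belowZ below_ge0. Qed.

Lemma le_component z w : 0 <= z -> D w -> w <= z -> g w <= component g D z.
Proof.
by move=> z0 Dw wz; rewrite /component cone_ext_pos//; exact: le_below.
Qed.

Lemma component_le z c : 0 <= z -> (forall w, D w -> w <= z -> g w <= c) ->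
  component g D z <= c.
Proof.
by move=> z0 h; rewrite /component cone_ext_pos//; exact: below_le.
Qed.

Lemma component_le_functional z : 0 <= z -> component g D z <= g z.
Proof. by move=> z0; apply: component_le => // w _; exact: functional_le. Qed.

Lemma component_ideal w : D w -> component g D w = g w.
Proof.
move=> Dw; have w0 := ideal_ge0 hD Dw.
by apply: le_anti; rewrite component_le_functional// le_component.
Qed.

End Component.

Definition principal_ideal w : set V :=
  [set v | 0 <= v /\ exists2 a, 0 <= a & v <= a *: w].

Lemma principal_ideal_ideal w : 0 <= w -> positive_ideal (principal_ideal w).
Proof.
move=> w0; split.
- by split=> //; exists 0; rewrite ?scale0r.
- by move=> v [].
- move=> u v [u0 [a a0 ua]] [v0 [b b0 vb]]; split; first exact: addv_ge0.
  by exists (a + b); rewrite ?addr_ge0// scalerDl levD.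
- move=> a v a0 [v0 [b b0 vb]]; split; first exact: scalev_ge0.
  by exists (a * b); rewrite ?mulr_ge0// -scalerA lev_wpscale.
- move=> u v /andP[u0 uv] [v0 [b b0 vb]]; split=> //.
  by exists b => //; exact: le_trans vb.
Qed.

(** The functionals [component g D] are numerous enough to compute [g] of a positive
    part: the positive part of [y] lies in the ideal that it generates, and the
    negative part is disjoint from that ideal. *)
Lemma component_vpos g y : positive_functional g ->
  component g (principal_ideal (vpos y)) y = g (vpos y).
Proof.
move=> hg; have hD := principal_ideal_ideal (vpos_ge0 y).
have hc := component_functional hg hD.
rewrite {2}(vposBN y) functionalB// component_ideal//; last first.
  by split; [exact: vpos_ge0|exists 1; rewrite ?scale1r].
suff -> : component g (principal_ideal (vpos y)) (vpos (- y)) = 0.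
  by rewrite subr0.
apply: le_anti; rewrite (functional_ge0 hc) ?vpos_ge0// andbT.
apply: component_le => // [|w [w0 [a a0 wa]] wn]; first exact: vpos_ge0.
by rewrite -(functional0 hg) functional_le// (vpos_disjoint a0 wa).
Qed.

End PositiveFunctionals.

(** * Domination on order intervals *)

Section DominatedIntervals.
Context {R : realType}.

(** A finite colouring stands for a finite net: colourings can be pulled back along
    maps and combined in products without choosing new centres. *)
Definition totally_bounded (U : Type) (A : set U) (d : U -> U -> R) : Prop :=
  forall e : R, 0 < e -> exists (I : finType) (c : U -> I),
    forall u v, A u -> A v -> c u = c v -> d u v < e.

Section Quotients.
Implicit Types s t l : R.

(** Convexity of the square: a splitting can only raise the sum of the [s ^+ 2 / t],
    and what it gains controls how far [s1 / t1] is from the ratio of the sums. The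
    degenerate cases rely on [x / 0 = 0]. *)
Lemma sqr_quot_split s1 t1 s2 t2 : 0 <= s1 <= t1 -> 0 <= s2 <= t2 ->
  let h := (s1 + s2) / (t1 + t2) in
  let gap := s1 ^+ 2 / t1 + s2 ^+ 2 / t2 - (s1 + s2) ^+ 2 / (t1 + t2) in
  0 <= gap /\
  forall l, 0 < l -> `|s1 - h * t1| <= l^-1 * gap + l * (t1 + t2).
Proof.
move=> /andP[s10 st1] /andP[s20 st2] h gap; set t := t1 + t2.
have t0 : 0 <= t by rewrite addr_ge0; lra.
have degenerate : s1 - h * t1 = 0 -> gap = 0 ->
    0 <= gap /\ forall l, 0 < l -> `|s1 - h * t1| <= l^-1 * gap + l * t.
  move=> -> ->; split=> // l l0.
  by rewrite normr0 mulr0 add0r mulr_ge0// ltW.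
have [t10|t10] := eqVneq t1 0.
  have s1E : s1 = 0 by lra.
  apply: degenerate; first by rewrite s1E t10 mulr0 subrr.
  by rewrite /gap s1E t10 !add0r expr0n mul0r add0r subrr.
have [t20|t20] := eqVneq t2 0.
  have s2E : s2 = 0 by lra.
  apply: degenerate; first by rewrite /h s2E t20 !addr0 divfK// subrr.
  by rewrite /gap s2E t20 !addr0 expr0n mul0r addr0 subrr.
have t1p : 0 < t1 by rewrite lt_def t10; lra.
have t2p : 0 < t2 by rewrite lt_def t20; lra.
have tp : 0 < t by rewrite addr_gt0.
set d := `|s1 * t2 - s2 * t1|.
have -> : `|s1 - h * t1| = d / t.
  have -> : s1 - h * t1 = (s1 * t2 - s2 * t1) / t.
    by rewrite /h /t; field; rewrite -/t gt_eqF.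
  by rewrite normrM normfV (gtr0_norm tp).
have -> : gap = d ^+ 2 / (t1 * t2 * t).
  rewrite /gap /d real_normK ?num_real// /t; field.
  by rewrite t10 t20 -/t gt_eqF.
split=> [|l l0]; first by rewrite divr_ge0 ?sqr_ge0 ?mulr_ge0 ?ltW.
have le1 : d ^+ 2 / t ^+ 3 <= d ^+ 2 / (t1 * t2 * t).
  rewrite ler_wpM2l ?sqr_ge0// lef_pV2 ?posrE ?mulr_gt0 ?exprn_gt0//.
  by rewrite exprSr ler_wpM2r ?ltW// /t; nra.
have le2 : d / t <= l^-1 * (d ^+ 2 / t ^+ 3) + l * t.
  rewrite -subr_ge0.
  have -> : l^-1 * (d ^+ 2 / t ^+ 3) + l * t - d / t =
      (l * t)^-1 * ((d / t - l * t / 2) ^+ 2 + 3 / 4 * (l * t) ^+ 2).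
    by field; rewrite !gt_eqF.
  apply: mulr_ge0; first by rewrite invr_ge0 ltW// mulr_gt0.
  by rewrite addr_ge0 ?sqr_ge0// mulr_ge0 ?sqr_ge0//; lra.
by apply: le_trans le2 _; rewrite lerD2r ler_wpM2l// invr_ge0 ltW.
Qed.

(** Merging the last three pieces first can only lower the sum, so the splitting
    into two pieces applies to the first piece against the rest. *)
Lemma sqr_quot_split4 s1 t1 s2 t2 s3 t3 s4 t4 l :
  0 <= s1 <= t1 -> 0 <= s2 <= t2 -> 0 <= s3 <= t3 -> 0 <= s4 <= t4 -> 0 < l ->
  let s := s1 + s2 + s3 + s4 in
  let t := t1 + t2 + t3 + t4 in
  `|s1 - s / t * t1| <=
    l^-1 * (s1 ^+ 2 / t1 + s2 ^+ 2 / t2 + s3 ^+ 2 / t3 + s4 ^+ 2 / t4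
            - s ^+ 2 / t) + l * t.
Proof.
move=> st1 st2 st3 st4 l0 /=.
have st34 : 0 <= s3 + s4 <= t3 + t4 by lra.
have st234 : 0 <= s2 + (s3 + s4) <= t2 + (t3 + t4) by lra.
have [g34 _] := sqr_quot_split st3 st4.
have [g234 _] := sqr_quot_split st2 st34.
have [_ /(_ l l0)] := sqr_quot_split st1 st234.
rewrite !addrA => /le_trans; apply; rewrite lerD2r.
by rewrite ler_wpM2l ?invr_ge0 ?(ltW l0)//; rewrite !addrA in g234; lra.
Qed.

End Quotients.

Lemma sum_pair_bool (W : nmodType) (I : finType) (f : I * bool -> W) :
  \sum_p f p = \sum_i (f (i, true) + f (i, false)).
Proof.
transitivity (\sum_i \sum_(c : bool) f (i, c)).
  by rewrite pair_bigA; apply: eq_bigr => -[].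
by apply: eq_bigr => i _; rewrite big_bool.
Qed.

Section Energy.
Context {E F : vectorLatticeType R} (S T : {linear E -> F}).
Context (g : F -> R) (x : E).
Hypotheses (S_ge0 : forall z : E, 0 <= z -> 0 <= S z)
  (S_le : forall z : E, 0 <= z -> S z <= T z).
Hypotheses (hg : positive_functional g) (x0 : 0 <= x).

(** A decomposition of [x] together with one of the functional [g], the counterpart
    of a partition of a product space into rectangles; the cell [(i, j)] has the
    masses [k i (S (a j))] and [k i (T (a j))]. *)
Record grid (I J : finType) (k : I -> F -> R) (a : J -> E) : Prop := {
  grid_functional : forall i, positive_functional (k i);
  grid_functional_sum : forall y, \sum_i k i y = g y;
  grid_ge0 : forall j, 0 <= a j;
  grid_sum : \sum_j a j = x
}.

(** For measures [s <= t] this is the integral with respect to [t] of the square of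
    the density of [s] averaged over the cells of the grid: it grows under
    refinement and stays below the mass of [t]. *)
Definition energy (I J : finType) (k : I -> F -> R) (a : J -> E) : R :=
  \sum_i \sum_j k i (S (a j)) ^+ 2 / k i (T (a j)).

Lemma cell_bounds (k : F -> R) (z : E) : positive_functional k -> 0 <= z ->
  0 <= k (S z) <= k (T z).
Proof.
by move=> hk z0; rewrite (functional_ge0 hk) ?S_ge0// functional_le// S_le.
Qed.

Lemma grid_mass (I J : finType) (k : I -> F -> R) (a : J -> E) (U : {linear E -> F}) :
  grid k a -> \sum_i \sum_j k i (U (a j)) = g (U x).
Proof.
move=> hka; rewrite -(grid_sum hka) -(grid_functional_sum hka).
by apply: eq_bigr => i _; rewrite linear_sum (functional_sum (grid_functional hka i)).
Qed.

Lemma energy_le (I J : finType) (k : I -> F -> R) (a : J -> E) :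
  grid k a -> energy k a <= g (T x).
Proof.
move=> hka; rewrite -(grid_mass T hka); apply: ler_sum => i _.
apply: ler_sum => j _.
have /andP[s0 st] := cell_bounds (grid_functional hka i) (grid_ge0 hka j).
have [->|t0] := eqVneq (k i (T (a j))) 0; first by rewrite invr0 mulr0.
rewrite ler_pdivrMr ?lt_def ?t0 ?(le_trans s0)//.
by rewrite expr2 ler_pM.
Qed.

(** With [refine_elements], this cuts each cell into four. *)
Definition refine_functionals (I : finType) (k : I -> F -> R) (D : set F)
  (p : I * bool) (y : F) : R :=
  if p.2 then component (k p.1) D y else k p.1 y - component (k p.1) D y.

Definition refine_elements (J : finType) (a b : J -> E) (p : J * bool) : E :=
  if p.2 then b p.1 else a p.1 - b p.1.

Lemma refine_grid (I J : finType) (k : I -> F -> R) (a b : J -> E) (D : set F) :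
  grid k a -> positive_ideal D -> (forall j, 0 <= b j <= a j) ->
  grid (refine_functionals k D) (refine_elements a b).
Proof.
move=> hka hD ba.
have hc i := component_functional (grid_functional hka i) hD.
split=> [[i [|]]|y|[j [|]]|]; rewrite /refine_functionals /refine_elements /=.
- exact: hc.
- split=> [t y z|y y0].
    rewrite (functional_linear (hc i)).
    by rewrite (functional_linear (grid_functional hka i)); ring.
  by rewrite subr_ge0; apply: component_le_functional; first exact: (grid_functional hka).
- rewrite -(grid_functional_sum hka) sum_pair_bool.
  by apply: eq_bigr => i _ /=; rewrite addrC subrK.
- by have /andP[] := ba j.
- by have /andP[_] := ba j; rewrite subv_ge0.
- rewrite -(grid_sum hka) sum_pair_bool.
  by apply: eq_bigr => j _ /=; rewrite addrC subrK.
Qed.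

Lemma refine_energy (I J : finType) (k : I -> F -> R) (a b : J -> E) (D : set F) l :
  grid k a -> positive_ideal D -> (forall j, 0 <= b j <= a j) -> 0 < l ->
  \sum_i \sum_j `|component (k i) D (S (b j))
      - k i (S (a j)) / k i (T (a j)) * component (k i) D (T (b j))| <=
  l^-1 * (energy (refine_functionals k D) (refine_elements a b) - energy k a)
    + l * g (T x).
Proof.
move=> hka hD ba l0; have hr := refine_grid hka hD ba.
rewrite /energy sum_pair_bool -(grid_mass T hka) -sumrB !mulr_sumr -big_split /=.
apply: ler_sum => i _; rewrite !sum_pair_bool -big_split -sumrB !mulr_sumr -big_split /=.
apply: ler_sum => j _; rewrite !addrA.
have hr1 := grid_functional hr (i, true); have hr2 := grid_functional hr (i, false).
have b1 := grid_ge0 hr (j, true); have b2 := grid_ge0 hr (j, false).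
have := sqr_quot_split4 (cell_bounds hr1 b1) (cell_bounds hr1 b2)
  (cell_bounds hr2 b1) (cell_bounds hr2 b2) l0.
have cellE (U : {linear E -> F}) :
    refine_functionals k D (i, true) (U (refine_elements a b (j, true)))
    + refine_functionals k D (i, true) (U (refine_elements a b (j, false)))
    + refine_functionals k D (i, false) (U (refine_elements a b (j, true)))
    + refine_functionals k D (i, false) (U (refine_elements a b (j, false)))
    = k i (U (a j)).
  rewrite /refine_functionals /refine_elements /= linearB.
  rewrite (functionalB (grid_functional hka i)).
  by rewrite (functionalB (component_functional (grid_functional hka i) hD)); ring.
rewrite !cellE /=; exact.
Qed.

(** A grid of almost maximal energy: refining it gains almost nothing, so on each
    of its cells [S] is almost the constant multiple [k i (S (a j)) / k i (T (a j))]
    of [T], uniformly over the refinements. *)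
Lemma almost_step_multiple (e : R) : 0 < e ->
  exists (I J : finType) (k : I -> F -> R) (a : J -> E), grid k a /\
    forall (D : set F) (b : J -> E), positive_ideal D ->
      (forall j, 0 <= b j <= a j) ->
      \sum_i \sum_j `|component (k i) D (S (b j))
        - k i (S (a j)) / k i (T (a j)) * component (k i) D (T (b j))| <= e.
Proof.
move=> e0; set m := g (T x).
have Tx0 : 0 <= T x by rewrite (le_trans (S_ge0 x0)) ?S_le.
have m0 : 0 <= m by exact: functional_ge0.
pose l := e / (2 * (m + 1)); have l0 : 0 < l by rewrite divr_gt0// mulr_gt0//; lra.
pose A : set R := [set r | exists (I J : finType) (k : I -> F -> R) (a : J -> E),
  grid k a /\ energy k a = r].
have g1 : grid (fun _ : unit => g) (fun _ : unit => x).
  by split=> //= [y|]; rewrite big_const card_unit /= addr0.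
have A0 : has_sup A.
  split; first by exists (energy (fun _ : unit => g) (fun _ : unit => x)),
    unit, unit, (fun=> g), (fun=> x).
  by exists m => _ [I [J [k [a [hka <-]]]]]; exact: energy_le.
have gap0 : 0 < l * e / 2 by apply: divr_gt0 => //; exact: mulr_gt0.
have [_ [I [J [k [a [hka <-]]]]] maxka] := sup_adherent gap0 A0.
exists I, J, k, a; split=> // D b hD ba.
apply: le_trans (refine_energy hka hD ba l0) _; rewrite -/m.
have : energy (refine_functionals k D) (refine_elements a b) <= sup A.
  apply: ub_le_sup; first by case: A0.
  by exists (I * bool)%type, (J * bool)%type, (refine_functionals k D),
    (refine_elements a b); split=> //; exact: refine_grid.
move=> leA.
have gain : energy (refine_functionals k D) (refine_elements a b) - energy k a
    <= l * e / 2 by lra.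
have lm : l * m <= e / 2.
  rewrite /l -mulrA ler_wpM2l ?(ltW e0)// mulrC ler_pdivrMr ?mulr_gt0//; lra.
have : l^-1 * (energy (refine_functionals k D) (refine_elements a b) - energy k a)
    <= e / 2.
  by rewrite ler_pdivrMl// mulrA.
lra.
Qed.


(** The functional evaluates the positive part of a difference as a sum of components
    of the [k i], and on each of them [S] may be replaced by the multiple of [T]
    attached to the cell, at the total cost [e] for each of the two elements. *)
Lemma pos_part_estimate (e : R) (I J : finType) (k : I -> F -> R)
    (a b b' : J -> E) : grid k a ->
  (forall (D : set F) (b : J -> E), positive_ideal D ->
      (forall j, 0 <= b j <= a j) ->
      \sum_i \sum_j `|component (k i) D (S (b j))
        - k i (S (a j)) / k i (T (a j)) * component (k i) D (T (b j))| <= e) ->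
  (forall j, 0 <= b j <= a j) -> (forall j, 0 <= b' j <= a j) ->
  g (vpos (S (\sum_j b j) - S (\sum_j b' j))) <=
  e + e + \sum_j g (labs (T (b j) - T (b' j))).
Proof.
move=> hka step ba ba'; set y := S _ - S _.
pose D := principal_ideal (vpos y).
have hD : positive_ideal D := principal_ideal_ideal (vpos_ge0 y).
have hc i := component_functional (grid_functional hka i) hD.
have -> : g (vpos y) = \sum_i \sum_j
    (component (k i) D (S (b j)) - component (k i) D (S (b' j))).
  rewrite -(grid_functional_sum hka); apply: eq_bigr => i _.
  rewrite -(component_vpos _ (grid_functional hka i)) sumrB -!(functional_sum (hc i)).
  by rewrite -!linear_sum -(functionalB (hc i)).
have -> : \sum_j g (labs (T (b j) - T (b' j))) =
    \sum_i \sum_j k i (labs (T (b j) - T (b' j))).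
  rewrite exchange_big; apply: eq_bigr => j _.
  by rewrite (grid_functional_sum hka).
apply: le_trans (lerD (lerD (step D b hD ba) (step D b' hD ba')) (lexx _)).
rewrite -!big_split; apply: ler_sum => i _; rewrite -!big_split; apply: ler_sum => j _ /=.
set h := k i (S (a j)) / k i (T (a j)).
have [h0 h1] : 0 <= h /\ h <= 1.
  have /andP[s0 st] := cell_bounds (grid_functional hka i) (grid_ge0 hka j).
  split; first by rewrite divr_ge0// (le_trans s0).
  have [t0|t0] := eqVneq (k i (T (a j))) 0; first by rewrite /h t0 invr0 mulr0.
  by rewrite ler_pdivrMr ?mul1r// lt_def t0 (le_trans s0).
have le_k : h * (component (k i) D (T (b j)) - component (k i) D (T (b' j))) <=
    k i (labs (T (b j) - T (b' j))).
  rewrite -(functionalB (hc i)).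
  apply: (@le_trans _ _ (component (k i) D (labs (T (b j) - T (b' j))))).
    apply: (@le_trans _ _ (h * component (k i) D (labs (T (b j) - T (b' j))))).
      by rewrite ler_wpM2l// (functional_le (hc i))// vjoinl.
    by rewrite ler_piMl// (functional_ge0 (hc i))// labs_ge0.
  by apply: component_le_functional; rewrite ?labs_ge0//; exact: (grid_functional hka).
set u := component _ _ (S (b j)) in |- *; set u' := component _ _ (S (b' j)) in |- *.
move: le_k; set w := component _ _ _; set w' := component _ _ _ => le_k.
have := ler_norm (u - h * w); have := ler_norm (- (u' - h * w')); rewrite normrN.
lra.
Qed.

Let interval := [set z : E | 0 <= z <= x].

(** Fremlin's domination theorem for order intervals, in the seminorm of a single
    positive functional. Two elements of the interval are close under [S] as soon as
    their pieces in a grid of almost maximal energy are close under [T]; hence an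
    element is coloured by the colours of its pieces. *)
Lemma dominated_interval :
  totally_bounded interval (fun z z' => g (labs (T z - T z'))) ->
  totally_bounded interval (fun z z' => g (labs (S z - S z'))).
Proof.
move=> tbT e e0; have e8 : 0 < e / 8 by lra.
have [I [J [k [a [hka step]]]]] := almost_step_multiple e8.
pose n : R := #|J|%:R + 1; have n0 : 0 < n by rewrite ltr_wpDl ?ler0n.
have en0 : 0 < e / 8 / n by rewrite divr_gt0.
have [K [c hc]] := tbT _ en0.
have /choice[dec hdec] (z : E) : exists b : J -> E, interval z ->
    (forall j, 0 <= b j <= a j) /\ \sum_j b j = z.
  have [iz|niz] := pselect (interval z); last by exists a.
  have [||b ba bz] := @Riesz_decomposition_sum R E J (index_enum J) a z (index_enum_uniq J).
  - exact: grid_ge0 hka.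
  - by rewrite (grid_sum hka).
  by exists b.
exists {ffun J -> K}, (fun z => [ffun j => c (dec z j)]) => z z' iz iz' cE.
have [ba bz] := hdec _ iz; have [ba' bz'] := hdec _ iz'.
have a_le j : a j <= x.
  rewrite -(grid_sum hka) (bigD1 j)//= -[leLHS]addr0 levD2lE.
  by rewrite big_mkcond sumv_ge0// => l; case: ifP => // _; exact: (grid_ge0 hka).
have ib b j : (forall j, 0 <= b j <= a j) -> interval (b j).
  by move=> /(_ j)/andP[b0 bj]; rewrite /interval /= b0 (le_trans bj).
have small : \sum_j g (labs (T (dec z j) - T (dec z' j))) <= e / 8.
  apply: (@le_trans _ _ (\sum_(j in J) e / 8 / n)).
    apply: ler_sum => j _; apply/ltW/hc; [exact: ib|exact: ib|].
    by have /ffunP/(_ j) := cE; rewrite !ffunE.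
  by rewrite sumr_const -[_ *+ #|J|]mulr_natr mulrAC ler_pdivrMr// ler_wpM2l ?(ltW e8)// lerDl.
have small' : \sum_j g (labs (T (dec z' j) - T (dec z j))) <= e / 8.
  under eq_bigr => j _ do rewrite -labsN opprB.
  exact: small.
rewrite labsE functionalD// opprB.
have := pos_part_estimate hka step ba ba'.
have := pos_part_estimate hka step ba' ba.
by rewrite bz bz'; lra.
Qed.

End Energy.
End DominatedIntervals.

(** * Null sequences and powers of one half *)

Section DyadicSequences.
Context {R : realType}.

Lemma cvgn0P (u : nat -> R) : u @ \oo --> (0 : R) <->
  forall e : R, 0 < e -> exists N, forall n, (N <= n)%N -> `|u n| < e.
Proof.
split=> [/cvgrPdist_lt h e e0|h].
  have [N _ hN] := h e e0; exists N => n Nn.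
  by rewrite -normrN -sub0r; exact: hN.
apply/cvgrPdist_lt => e e0; have [N hN] := h e e0; exists N => // n Nn.
by rewrite sub0r normrN; exact: hN.
Qed.

Definition dyadic n : R := 2^-1 ^+ n.

Lemma dyadic_gt0 n : 0 < dyadic n.
Proof. by rewrite exprn_gt0// invr_gt0. Qed.

Lemma dyadicK n : dyadic n * 2 ^+ n = 1.
Proof. by rewrite -exprMn mulVf// expr1n. Qed.

Lemma dyadic_small (c e : R) : 0 < e ->
  exists N, forall n, (N <= n)%N -> c * dyadic n < e.
Proof.
move=> e0; have c0 : 0 < `|c| + 1 by rewrite ltr_wpDl.
have half : `|2^-1 : R| < 1 by rewrite ger0_norm ?invr_ge0//; lra.
have [N hN] := (cvgn0P _).1 (cvg_expr half) _ (divr_gt0 e0 c0).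
exists N => n /hN; rewrite ger0_norm ?ltW ?dyadic_gt0// ltr_pdivlMr// mulrC.
apply: le_lt_trans; rewrite ler_wpM2r ?ltW ?dyadic_gt0//.
by have := ler_norm c; lra.
Qed.

Lemma dyadic_tail n m : \sum_(n <= k < m) dyadic k <= 2 * dyadic n.
Proof.
case: (leqP n m) => [nm|mn]; last first.
  by rewrite big_geq ?(ltnW mn)// mulr_ge0// ltW// dyadic_gt0.
rewrite (eq_bigr (fun k => (- 2 * dyadic k.+1) - (- 2 * dyadic k))).
  rewrite (telescope_sumr (fun k => - 2 * dyadic k))//.
  by have := dyadic_gt0 m; lra.
by move=> k _; rewrite /dyadic exprS; lra.
Qed.

End DyadicSequences.

(** * Order continuity of the dual norm *)

Section DualOrderContinuity.
Context {R : realType} {V : vectorLatticeType R} (N : V -> R).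
Hypothesis hN : lattice_seminorm N.
Hypothesis oc : order_continuous_norm (dual_norm N).

Lemma dual_of_functional (f : V -> R) (C : R) : positive_functional f ->
  (forall x, 0 <= x -> f x <= C * N x) ->
  exists F : dual N, forall x, F x = f x.
Proof.
move=> hf fC; have fP : (f : V -> R^o) \in dual_pred N.
  apply/asboolP; split; first by move=> a x y; exact: (functional_linear hf).
  exists C => x; apply: le_trans (functional_norm hf x) _.
  by rewrite -[N x](seminorm_labs hN) fC// labs_ge0.
by exists (Dual fP).
Qed.

Lemma dual_norm_ge (F : dual N) (x : V) : N x <= 1 -> `|F x : R| <= dual_norm N F.
Proof.
move=> x1; apply: ub_le_sup; last by exists x.
have /asboolP[_ [C hC]] := valP F.
exists `|C| => _ [y /= y1 <-]; apply: le_trans (hC y) _.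
apply: le_trans (ler_norm _) _; rewrite normrM ler_piMr//.
by rewrite ger0_norm// seminorm_ge0.
Qed.

(** The pointwise limit of a decreasing sequence of positive functionals is its
    infimum in the dual, so that order continuity of the dual norm turns pointwise
    convergence into uniform convergence on the unit ball. *)
Lemma decreasing_functionals (f : nat -> V -> R) (C : R) :
  (forall n, positive_functional (f n)) ->
  (forall n m x, (n <= m)%N -> 0 <= x -> f m x <= f n x) ->
  (forall x, 0 <= x -> f 0%N x <= C * N x) ->
  exists fl : V -> R, [/\ positive_functional fl,
    (forall n x, 0 <= x -> fl x <= f n x) &
    forall e : R, 0 < e -> exists n, forall m, (n <= m)%N ->
      forall x, N x <= 1 -> f m x - fl x < e].
Proof.
move=> hf f_dec fC.
have cvg_pos x : 0 <= x -> cvgn (f ^~ x).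
  move=> x0; apply: nonincreasing_is_cvgn => [n m nm|]; first exact: f_dec.
  by exists 0 => _ [n _ <-]; exact: functional_ge0.
have cvg_f x : cvgn (f ^~ x).
  have -> : f ^~ x = (f ^~ (vpos x) - f ^~ (vpos (- x)) : nat -> R).
    by apply/funext => n; rewrite {1}(vposBN x) (functionalB (hf n)).
  by apply: is_cvgB; apply: cvg_pos; exact: vpos_ge0.
pose fl x : R := limn (f ^~ x).
have fl_le n x : 0 <= x -> fl x <= f n x.
  move=> x0; apply: (@nonincreasing_cvgn_ge _ (f ^~ x)) => [m k mk|]; first exact: f_dec.
  exact: cvg_f.
have hfl : positive_functional fl.
  split=> [a x y|x x0]; last first.
    by apply: limr_ge; [exact: cvg_f|near=> n; exact: functional_ge0].
  rewrite /fl; apply: cvg_lim => //.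
  have -> : f ^~ (a *: x + y) = (a *: (f ^~ x : nat -> R^o) + f ^~ y : nat -> R).
    by apply/funext => n; rewrite (functional_linear (hf n)).
  by apply: cvgD; [apply: cvgZr; exact: cvg_f|exact: cvg_f].
exists fl; split=> //.
have /choice[G hG] n : exists F : dual N, forall x, F x = f n x.
  apply: (@dual_of_functional _ C) => // x x0.
  by apply: le_trans (fC x x0); exact: f_dec.
have [L hL] : exists F : dual N, forall x, F x = fl x.
  apply: (@dual_of_functional _ C) => // x x0.
  by apply: le_trans (fC x x0); exact: fl_le.
have nat_dir : directed (fun n m : nat => (n <= m)%N).
  split=> [|//|a b c|a b]; [exact: (inhabits 0%N)|exact: leq_trans|].
  by exists (maxn a b); rewrite leq_maxl leq_maxr.
have G_dec n m : (n <= m)%N -> G m <= G n.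
  by move=> nm; apply/asboolP => x x0; rewrite !hG; exact: f_dec.
have G_ge n : L <= G n.
  by apply/asboolP => x x0; rewrite hL hG; exact: fl_le.
have Gcvg : order_cvg (fun n m : nat => (n <= m)%N) G L.
  exists nat, (fun n m : nat => (n <= m)%N), (fun n => G n - L).
  split=> [//||b]; last first.
    exists b => a ba; split; first by rewrite levD2rE G_dec.
    by apply: (@le_trans _ _ 0); rewrite ?oppv_le0 subv_ge0 G_ge.
  split=> [b b' bb'|]; first by rewrite levD2rE G_dec.
  split=> [_ [n _ <-]|H Hle]; first by rewrite subv_ge0 G_ge.
  apply/asboolP => x x0.
  suff : (H x : R) <= fl x - fl x by rewrite subrr.
  have HE n : (H x : R) <= f n x - fl x.
    have /asboolP/(_ x x0) := Hle _ (imageT (fun n => G n - L) n).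
    by rewrite -hG -hL.
  rewrite lerBrDr {2}/fl; apply: limr_ge; first exact: cvg_f.
  by near=> n; rewrite -lerBrDr.
move=> e e0; have [n hn] := oc nat_dir Gcvg e0.
exists n => m nm x x1; apply: le_lt_trans (hn m nm).
apply: le_trans (dual_norm_ge (G m - L) x1).
by apply: le_trans (ler_norm _); rewrite -hG -hL.
Unshelve. all: by end_near.
Qed.


(** The positive cone of the ideal generated by the terms of [v] from [n] on. *)
Definition tail_ideal (v : nat -> V) (n : nat) : set V :=
  [set w | 0 <= w /\ exists (a : R) (m : nat), 0 <= a /\ w <= a *: \sum_(n <= k < m) v k].

Section TailIdeal.
Context (v : nat -> V).
Hypothesis v0 : forall k, 0 <= v k.

Lemma tail_sum_le n m m' : (n <= m)%N -> (m <= m')%N ->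
  \sum_(n <= k < m) v k <= \sum_(n <= k < m') v k.
Proof.
move=> nm mm'; rewrite (big_cat_nat nm mm') /= -[leLHS]addr0.
by rewrite levD2lE sumv_ge0.
Qed.

Lemma tail_ideal_witness n w : tail_ideal v n w -> exists (a : R) (m : nat),
  [/\ 0 <= a, (n <= m)%N & w <= a *: \sum_(n <= k < m) v k].
Proof.
move=> [w0 [a [m [a0 wm]]]]; have [nm|mn] := leqP n m; first by exists a, m.
exists a, n; split=> //; rewrite (big_geq (leqnn n)).
by rewrite (big_geq (ltnW mn)) in wm.
Qed.

Lemma tail_ideal_ideal n : positive_ideal (tail_ideal v n).
Proof.
split.
- by split=> //; exists 0, 0%N; rewrite scale0r.
- by move=> w [].
- move=> u w nu nw; split; first by apply: addv_ge0; [case: nu|case: nw].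
  have [a [m [a0 nm um]]] := tail_ideal_witness nu.
  have [b [l [b0 nl wl]]] := tail_ideal_witness nw.
  exists (a + b), (maxn m l); split; first by rewrite addr_ge0.
  rewrite scalerDl; apply: levD.
    by apply: le_trans um _; rewrite lev_wpscale// tail_sum_le// leq_maxl.
  by apply: le_trans wl _; rewrite lev_wpscale// tail_sum_le// leq_maxr.
- move=> b w b0 [w0 [a [m [a0 wm]]]]; split; first exact: scalev_ge0.
  by exists (b * a), m; rewrite mulr_ge0// -scalerA lev_wpscale.
- move=> u w /andP[u0 uw] [w0 [a [m [a0 wm]]]]; split=> //.
  by exists a, m; split=> //; exact: le_trans wm.
Qed.

Lemma tail_ideal_sub n n' w : (n <= n')%N -> tail_ideal v n' w -> tail_ideal v n w.
Proof.
move=> nn' nw; have [a [m [a0 nm wm]]] := tail_ideal_witness nw.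
split; first by case: nw.
exists a, m; split=> //; apply: le_trans wm _; apply: lev_wpscale => //.
by rewrite (big_cat_nat nn' nm)/= -[leLHS]add0r levD2rE sumv_ge0.
Qed.

End TailIdeal.

(** Where [z - c] is positive, [b <= c <= z]; elsewhere [b <= 0 <= z]. *)
Lemma le_of_disjoint_excess (a : R) (b c z : V) : 0 <= a -> 0 <= z ->
  b <= c -> b <= a *: vpos (z - c) -> b <= z.
Proof.
move=> a0 z0 bc bz; rewrite -subv_ge0 -oppv_le0 opprB.
have -> : (b - z <= 0) = (vpos (b - z) <= 0) by rewrite vpos_le lexx andbT.
apply: (vpos_disjoint (b := a) (x := z - c)) => //.
  rewrite vpos_le scalev_ge0 ?vpos_ge0// andbT; apply: le_trans bz.
  by rewrite levBlDr -[leLHS]addr0 levD2lE.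
by apply: vpos_mono; rewrite opprB levD2rE.
Qed.

(** By contradiction, a gliding hump. If no [x] works, there are [z n] in the unit
    ball such that [f] exceeds [e] at [v n], the positive part of
    [z n - 2 ^+ n *: (z 0 + .. + z (n - 1))]. Let [chi n] be the part of [f] carried by
    the ideal generated by the [v k] with [n <= k]. On the ideal generated by [v k]
    alone the earlier [z m] are dominated by [2 ^- k *: z k], hence [chi n (z m)]
    tends to zero and the limit of the [chi n] vanishes at every [v m]. But
    [chi n (v n)] exceeds [e], against the uniform convergence of the [chi n]. *)
Lemma almost_order_bounded (f : V -> R) (C e : R) : positive_functional f ->
  (forall x, 0 <= x -> f x <= C * N x) -> 0 < e ->
  exists2 x, 0 <= x & forall z, 0 <= z -> N z <= 1 -> f (vpos (z - x)) <= e.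
Proof.
move=> hf fC e0; apply: contrapT => hno.
have /choice[zeta hzeta] (x : V) : exists z, 0 <= x ->
    [/\ 0 <= z, N z <= 1 & e < f (vpos (z - x))].
  have [x0|nx0] := pselect (0 <= x); last by exists 0.
  apply: contrapT => hz; apply: hno; exists x => // z z0 z1.
  by rewrite leNgt; apply/negP => fz; apply: hz; exists z.
pose u := fix u n : V := if n is m.+1 then u m + zeta ((2 ^+ m : R) *: u m) else 0.
pose z n := zeta ((2 ^+ n : R) *: u n); pose v n := vpos (z n - (2 ^+ n : R) *: u n).
have u0 n : 0 <= u n.
  elim: n => [|n un] //=; apply: addv_ge0 => //.
  by have [] := hzeta ((2 ^+ n : R) *: u n); rewrite ?scalev_ge0 ?exprn_ge0.
have hz n : [/\ 0 <= z n, N (z n) <= 1 & e < f (v n)].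
  by apply: hzeta; rewrite scalev_ge0 ?exprn_ge0.
have v0 n : 0 <= v n by exact: vpos_ge0.
have vz n : v n <= z n.
  have [zn _ _] := hz n.
  by rewrite vpos_le zn levBlDr -[leLHS]addr0 levD2lE scalev_ge0 ?exprn_ge0.
have zu m n : (m < n)%N -> z m <= u n.
  elim: n => // n IHn; rewrite ltnS leq_eqVlt => /predU1P[->|/IHn mn] /=.
    by rewrite -[leLHS]add0r levD2rE.
  by rewrite -[leLHS]addr0 levD//; have [] := hz n.
have N1_f y : 0 <= y -> N y <= 1 -> f y <= `|C|.
  move=> y0 y1; apply: le_trans (fC _ y0) _; apply: le_trans (ler_norm _) _.
  by rewrite normrM ler_piMr// ger0_norm ?seminorm_ge0.
pose chi n := component f (tail_ideal v n).
have hI n := tail_ideal_ideal v0 n.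
have hchi n : positive_functional (chi n) := component_functional hf (hI n).
have chi_dec n m x : (n <= m)%N -> 0 <= x -> chi m x <= chi n x.
  move=> nm x0; apply: component_le => // w mw wx.
  by apply: le_component => //; exact: tail_ideal_sub mw.
have chiC x : 0 <= x -> chi 0%N x <= C * N x.
  by move=> x0; apply: le_trans (fC x x0); exact: component_le_functional.
have [chil [hl chil_le chil_cvg]] := decreasing_functionals hchi chi_dec chiC.
have chi_small m n : (m < n)%N -> chi n (z m) <= `|C| * (2 * dyadic n).
  move=> mn; have [zm0 _ _] := hz m.
  apply: component_le => // w nw wz.
  have [a [l [a0 _ wl]]] := tail_ideal_witness nw.
  have w0 : 0 <= w by case: nw.
  rewrite scaler_sumr in wl.
  have [||b hb bw] := @Riesz_decomposition_sum _ _ _ (index_iota n l)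
      (fun k => a *: v k) w (iota_uniq _ _).
  - by move=> k; exact: scalev_ge0.
  - by rewrite w0.
  rewrite -bw (functional_sum hf).
  apply: (@le_trans _ _ (\sum_(n <= k < l) `|C| * dyadic k)); last first.
    by rewrite -mulr_sumr ler_wpM2l// dyadic_tail.
  rewrite big_seq [leRHS]big_seq; apply: ler_sum => k kl.
  have /andP[nk _] : (n <= k < l)%N by rewrite -mem_index_iota.
  have /andP[bk0 bkv] := hb k.
  have bku : b k <= u k.
    apply: le_trans (zu m k (leq_trans mn nk)); apply: le_trans wz.
    rewrite -bw (bigD1_seq k) ?iota_uniq//= -[leLHS]addr0 levD2lE.
    by rewrite big_mkcond sumv_ge0// => j; case: ifP => // _; have /andP[] := hb j.
  have [zk0 zk1 _] := hz k.
  rewrite -[f _]mulr1 -(dyadicK k) mulrCA mulrC ler_wpM2r ?(ltW (dyadic_gt0 k))//.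
  rewrite mulrC -(functionalZ hf); apply: le_trans (N1_f _ zk0 zk1).
  apply: (functional_le hf).
  apply: (@le_of_disjoint_excess (2 ^+ k * a) _ ((2 ^+ k : R) *: u k)) => //.
  - by rewrite mulr_ge0// exprn_ge0.
  - by rewrite lev_wpscale// exprn_ge0.
  - by rewrite -scalerA lev_wpscale// exprn_ge0.
have chil_v m : chil (v m) <= 0.
  rewrite leNgt; apply/negP => cv; have [M hM] := dyadic_small (`|C| * 2) cv.
  pose n := maxn M m.+1; have := hM n (leq_maxl _ _); rewrite ltNge => /negP; apply.
  rewrite -mulrA; apply: le_trans (chi_small m n (leq_maxr _ _)).
  apply: (@le_trans _ _ (chil (z m))); first exact: (functional_le hl).
  by apply: chil_le; have [] := hz m.
have [n hn] := chil_cvg _ e0.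
have [zn0 zn1 fv] := hz n.
have vn1 : N (v n) <= 1.
  by apply: le_trans zn1; apply: (seminorm_le hN); rewrite v0 vz.
have : f (v n) <= chi n (v n).
  apply: le_component => //; split=> //; exists 1, n.+1.
  by rewrite big_nat1 scale1r.
by have := hn n (leqnn n) (v n) vn1; have := chil_v n; lra.
Qed.

End DualOrderContinuity.

(** * The Hahn-Banach theorem *)

Section HahnBanach.
Context {R : realType} {V : lmodType R}.
Implicit Types (m P : V -> R) (x y w : V).

Record sublinear P : Prop := {
  sublinearD : forall x y, P (x + y) <= P x + P y;
  sublinearZ : forall (a : R) x, 0 < a -> P (a *: x) <= a * P x
}.

Lemma sublinear0 P : sublinear P -> P 0 = 0.
Proof.
move=> hP; have half0 : 0 < 2^-1 :> R by rewrite invr_gt0.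
have := sublinearZ hP 0 half0; have := sublinearD hP 0 0.
by rewrite scaler0 addr0; lra.
Qed.

Lemma sublinear_geN P y : sublinear P -> - P (- y) <= P y.
Proof.
move=> hP; have := sublinearD hP y (- y).
by rewrite subrr (sublinear0 hP); lra.
Qed.

(** Used for the infimum of a chain and for the infimum along a ray. *)
Lemma inf_sublinear (K : Type) (k0 : K) (F : K -> V -> R) (L : V -> R) :
  (forall k y, L y <= F k y) ->
  (forall k l x y, exists i, F i (x + y) <= F k x + F l y) ->
  (forall k (a : R) x, 0 < a -> exists i, F i (a *: x) <= a * F k x) ->
  sublinear (fun y => inf (range (F ^~ y))).
Proof.
move=> FL FD FZ.
have le_inf_F k y : inf (range (F ^~ y)) <= F k y.
  by apply: ge_inf; [exists (L y) => _ [l _ <-]|exists k].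
have inf_ge c y : (forall k, c <= F k y) -> c <= inf (range (F ^~ y)).
  by move=> h; apply: lb_le_inf; [exists (F k0 y), k0|move=> _ [k _ <-]].
split=> [x y|a x a0].
  rewrite -lerBlDr; apply: (inf_ge) => k; rewrite lerBlDr -lerBlDl.
  apply: (inf_ge) => l; rewrite lerBlDl.
  by have [i Fi] := FD k l x y; exact: le_trans (le_inf_F i _) Fi.
rewrite -ler_pdivrMl//; apply: (inf_ge) => k; rewrite ler_pdivrMl//.
by have [i Fi] := FZ k a x a0; exact: le_trans (le_inf_F i _) Fi.
Qed.

(** The infimum over [t] is the largest sublinear functional below [m] whose value
    at [- w] is at most [- m w]; the absolute value lets [t] range over all of [R]. *)
Definition ray_shift m w (t : R) y : R := m (y + `|t| *: w) - `|t| * m w.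

Lemma ray_shift_geN m w t y : sublinear m -> - m (- y) <= ray_shift m w t y.
Proof.
move=> hm; rewrite /ray_shift; set s := `|t|.
have [->|s0] := eqVneq s 0.
  by rewrite scale0r addr0 mul0r subr0; exact: sublinear_geN.
have sp : 0 < s by rewrite lt_def s0 normr_ge0.
have si : 0 < s^-1 by rewrite invr_gt0.
have := sublinearD hm (y + s *: w) (- y); rewrite addrAC subrr add0r => h1.
have := sublinearZ hm (s *: w) si.
by rewrite scalerA mulVf// scale1r ler_pdivlMl//; lra.
Qed.

Lemma ray_shift_sublinear m w : sublinear m ->
  sublinear (fun y => inf (range (ray_shift m w ^~ y))).
Proof.
move=> hm; apply: (inf_sublinear 0 (L := fun y => - m (- y))).
- by move=> t y; exact: ray_shift_geN.
- move=> t s x y; exists (`|t| + `|s|); rewrite /ray_shift ger0_norm ?addr_ge0//.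
  rewrite scalerDl addrACA; have := sublinearD hm (x + `|t| *: w) (y + `|s| *: w).
  lra.
- move=> t a x a0; exists (a * t); rewrite /ray_shift normrM (gtr0_norm a0).
  rewrite -scalerA -scalerDr; have := sublinearZ hm (x + `|t| *: w) a0.
  lra.
Qed.

Lemma ray_shift_le m w t y : sublinear m ->
  inf (range (ray_shift m w ^~ y)) <= ray_shift m w t y.
Proof.
move=> hm; apply: ge_inf; last by exists t.
by exists (- m (- y)) => _ [s _ <-]; exact: ray_shift_geN.
Qed.

(** Zorn's lemma; a chain is bounded below by its pointwise infimum, which is finite
    because every sublinear [m] below [P] satisfies [- P (- y) <= m y]. *)
Lemma minimal_sublinear P : sublinear P -> exists m, [/\ sublinear m,
  (forall y, m y <= P y) &
  forall n, sublinear n -> (forall y, n y <= m y) -> forall y, m y <= n y].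
Proof.
move=> hP; pose T := {m | sublinear m /\ forall y, m y <= P y}.
pose ge (s t : T) := `[< forall y, sval t y <= sval s y >].
pose t0 : T := exist _ P (conj hP (fun y => lexx (P y))).
have ge_refl t : ge t t by exact/asboolP.
have ge_trans r s t : ge r s -> ge s t -> ge r t.
  by move=> /asboolP rs /asboolP st; apply/asboolP => y; exact: le_trans (st y) (rs y).
have [A|[m [hm mP]] minm] := ZL_preorder t0 ge_refl ge_trans; last first.
  exists m; split=> // n hn nm.
  have nP y : n y <= P y by exact: le_trans (nm y) (mP y).
  by have /asboolP := minm (exist _ n (conj hn nP)) (introT (asboolP _) nm).
move=> Atot; have [[a Aa]|A0] := pselect (exists a, A a); last first.
  by exists t0 => s As; case: A0; exists s.
pose F (k : {t | A t}) : V -> R := sval (sval k).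
have FL k y : - P (- y) <= F k y.
  rewrite /F; case: k => [[m [hm mP]] _] /=.
  by apply: le_trans (sublinear_geN y hm); rewrite lerN2.
have hF : sublinear (fun y => inf (range (F ^~ y))).
  apply: (inf_sublinear (exist _ a Aa) FL) => [k l x y|k c x c0]; last first.
    by exists k; rewrite /F; case: k => [[m [hm mP]] _] /=; exact: sublinearZ.
  have hk i : sublinear (F i) by rewrite /F; case: i => [[m []]].
  have [/asboolP kl|/asboolP lk] := Atot _ _ (svalP k) (svalP l).
    exists l; apply: le_trans (sublinearD (hk l) x y) _.
    by rewrite lerD2r; exact: kl.
  exists k; apply: le_trans (sublinearD (hk k) x y) _.
  by rewrite lerD2l; exact: lk.
have infF k y : inf (range (F ^~ y)) <= F k y.
  by apply: ge_inf; [exists (- P (- y)) => _ [l _ <-]|exists k].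
have infP y : inf (range (F ^~ y)) <= P y.
  by apply: le_trans (infF (exist _ a Aa) y) _; rewrite /F /=; case: (svalP a).
pose low : T := exist (fun m => sublinear m /\ forall y, m y <= P y) _ (conj hF infP).
exists low => s As; apply/asboolP => y /=.
exact: (infF (exist _ s As)).
Qed.

(** A minimal sublinear functional is linear, since lowering it along a ray cannot
    change it; starting from the majorant lowered along [w] makes it exact at [w]. *)
Theorem Hahn_Banach P w : sublinear P -> exists f : V -> R,
  [/\ forall (a : R) x y, f (a *: x + y) = a * f x + f y,
      forall y, f y <= P y & f w = P w].
Proof.
move=> hP; have [f [hf fP minf]] := minimal_sublinear (ray_shift_sublinear w hP).
have fle t y : f y <= ray_shift P w t y.
  by apply: le_trans (fP y) _; exact: ray_shift_le.
have fD x y : f (x + y) = f x + f y.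
  apply: le_anti; rewrite (sublinearD hf)/=.
  have shift_le z : inf (range (ray_shift f y ^~ z)) <= f z.
    apply: le_trans (ray_shift_le y 0 z hf) _.
    by rewrite /ray_shift normr0 scale0r addr0 mul0r subr0.
  have := minf _ (ray_shift_sublinear y hf) shift_le x.
  move=> /le_trans/(_ (ray_shift_le y 1 x hf)).
  by rewrite /ray_shift normr1 scale1r mul1r lerBrDr.
have f0 : f 0 = 0 by have := fD 0 0; rewrite addr0; lra.
have fN x : f (- x) = - f x by have := fD x (- x); rewrite subrr f0; lra.
have fZp (a : R) x : 0 < a -> f (a *: x) = a * f x.
  move=> a0; apply: le_anti; rewrite (sublinearZ hf)//=.
  have := sublinearZ hf (- x) a0; rewrite scalerN !fN; lra.
have fZ (a : R) x : f (a *: x) = a * f x.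
  have [a0|a0|<-] := ltgtP 0 a; [exact: fZp| |by rewrite scale0r mul0r].
  have na0 : 0 < - a by rewrite oppr_gt0.
  by have := fZp _ x na0; rewrite scaleNr fN; lra.
exists f; split=> [a x y|y|]; first by rewrite fD fZ.
  by have := fle 0 y; rewrite /ray_shift normr0 scale0r addr0 mul0r subr0.
apply: le_anti; apply/andP; split.
  by have := fle 0 w; rewrite /ray_shift normr0 scale0r addr0 mul0r subr0.
have := fle 1 (- w); rewrite /ray_shift normr1 scale1r mul1r addNr fN.
by rewrite (sublinear0 hP); lra.
Qed.

End HahnBanach.

Section NormingFunctional.
Context {R : realType} {V : vectorLatticeType R} (N : V -> R).
Hypothesis hN : lattice_seminorm N.

(** Taking the norm of the positive part as the sublinear majorant makes the
    functional given by the Hahn-Banach theorem positive. *)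
Lemma norming_functional (w : V) : 0 <= w -> exists f : V -> R,
  [/\ positive_functional f, forall x, 0 <= x -> f x <= N x & f w = N w].
Proof.
move=> w0; have hP : sublinear (fun x => N (vpos x)).
  split=> [x y|a x a0].
    apply: le_trans (seminormD hN _ _); apply: (seminorm_le hN).
    by rewrite vpos_ge0 vpos_le levD ?vpos_ge// addv_ge0 ?vpos_ge0.
  rewrite -{2}(gtr0_norm a0) -(seminormZ hN); apply: (seminorm_le hN).
  rewrite vpos_ge0 vpos_le lev_wpscale ?vpos_ge ?(ltW a0)//.
  by rewrite scalev_ge0 ?vpos_ge0 ?(ltW a0).
have [f [flin fP fw]] := Hahn_Banach w hP.
exists f; split=> [|x x0|]; last by rewrite fw vpos_id.
  split=> // x x0; have fN : f (- x) = - f x.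
    by have := flin (-1) x 0; have := flin 1 0 0; rewrite !scaler0 scaleN1r !addr0; lra.
  rewrite -oppr_le0 -fN; apply: le_trans (fP _) _.
  have -> : vpos (- x) = 0 by rewrite vposN vpos_id ?subrr.
  by rewrite (seminorm0 hN).
by apply: le_trans (fP x) _; rewrite vpos_id.
Qed.

End NormingFunctional.

(** * Banach lattices with an order continuous norm *)

Section OrderContinuousBanachLattices.
Context {R : realType} {F : vectorLatticeType R} (q : F -> R).
Hypothesis hB : Banach_lattice q.

Lemma Banach_lattice_seminorm : lattice_seminorm q.
Proof.
split; [exact: (is_normZ (Banach_lattice_norm hB))|
  exact: (is_normD (Banach_lattice_norm hB))|exact: (Banach_lattice_monotone hB)].
Qed.

Let hq := Banach_lattice_seminorm.

Lemma Banach_lattice_archimedean (x y : F) : (forall n : nat, n%:R *: x <= y) -> x <= 0.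
Proof.
move=> nxy; have bound n : n%:R * q (vpos x) <= q (vpos y).
  rewrite -[n%:R]normr_nat -(seminormZ hq); apply: (seminorm_le hq).
  rewrite scalev_ge0 ?vpos_ge0//=.
  have [->|n0] := eqVneq n 0%N; first by rewrite scale0r vpos_ge0.
  have np : 0 < n%:R :> R by rewrite ltr0n lt0n.
  rewrite -(levZ2l _ _ (_ : 0 < n%:R^-1)) ?invr_gt0// scalerA mulVf ?gt_eqF// scale1r.
  rewrite vpos_le scalev_ge0 ?vpos_ge0 ?invr_ge0 ?ler0n// andbT.
  rewrite -(levZ2l _ _ np) scalerA mulfV ?gt_eqF// scale1r.
  exact: le_trans (nxy n) (vpos_ge y).
have q0 : q (vpos x) = 0.
  apply: le_anti; rewrite seminorm_ge0// andbT leNgt; apply/negP => qx.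
  have := archi_boundP (divr_ge0 (seminorm_ge0 hq (vpos y)) (ltW qx)).
  by rewrite ltr_pdivrMr// ltNge bound.
by rewrite -(is_norm_eq0 (Banach_lattice_norm hB) q0) vpos_ge.
Qed.

Lemma le_norm_limit (b : nat -> F) (x l : F) : norm_cvg q b l ->
  (forall n, x <= b n) -> x <= l.
Proof.
move=> bl xb; rewrite -subv_ge0 -oppv_le0 opprB.
suff /(is_norm_eq0 (Banach_lattice_norm hB)) <- : q (vpos (x - l)) = 0.
  exact: vpos_ge.
apply: le_anti; rewrite seminorm_ge0// andbT leNgt; apply/negP => q0.
have [N /(_ N (leqnn N))] := (cvgn0P _).1 bl _ q0.
rewrite ltNge => /negP; apply; rewrite ger0_norm ?seminorm_ge0//.
apply: le_trans (seminorm_vpos hq _); apply: (seminorm_le hq).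
by rewrite vpos_ge0 vpos_mono// levD2rE.
Qed.

Hypothesis oc : order_continuous_norm q.

(** The differences between the upper bounds of the sequence and its terms form a
    net that decreases to zero. *)
Lemma increasing_Cauchy (a : nat -> F) (y : F) : (forall n, a n <= a n.+1) ->
  (forall n, a n <= y) -> forall e : R, 0 < e ->
  exists N, forall m n, (N <= m)%N -> (N <= n)%N -> q (a m - a n) < e.
Proof.
move=> a_inc ay e e0.
have a_le m n : (m <= n)%N -> a m <= a n.
  by move=> /subnK <-; elim: (n - m)%N => // k IHk; exact: le_trans IHk (a_inc _).
pose I := ({u : F | forall n, a n <= u} * nat)%type.
pose leI (i j : I) := sval j.1 <= sval i.1 /\ (i.2 <= j.2)%N.
pose x (i : I) := sval i.1 - a i.2.
have I_dir : directed leI.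
  split=> [|i|i j k [ij1 ij2] [jk1 jk2]|[[u hu] m] [[v hv] n]].
  - exact: (inhabits (exist _ y ay, 0%N)).
  - by split.
  - by split; [exact: le_trans jk1 ij1|exact: leq_trans ij2 jk2].
  have huv k : a k <= vmeet u v by rewrite le_vmeet hu hv.
  exists (exist (fun u => forall n, a n <= u) _ huv, maxn m n).
  by rewrite /leI /= vmeetl vmeetr leq_maxl leq_maxr.
have x_dec i j : leI i j -> x j <= x i.
  by move=> [ij1 ij2]; rewrite levD// levN2 a_le.
have x_ge0 i : 0 <= x i by rewrite subv_ge0; exact: (svalP i.1).
have x_inf : infimums (range x) 0.
  split=> [_ [i _ <-]|l hl]; first exact: x_ge0.
  have shift k u : (forall n, a n <= u) -> forall n, a n <= u - k%:R *: l.
    elim: k u => [|k IHk] u hu n; first by rewrite scale0r subr0.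
    rewrite -natr1 scalerDl scale1r opprD addrA addrAC; apply: IHk => m.
    rewrite levBrDr -levBrDl.
    exact: (hl _ (imageT x (exist (fun u => forall n, a n <= u) u hu, m))).
  apply: (@Banach_lattice_archimedean l (y - a 0%N)) => k.
  by rewrite levBrDl -levBrDr; exact: shift.
have x_cvg : order_cvg leI x 0.
  exists I, leI, x; split=> // i; exists i => j ij; rewrite subr0 x_dec//.
  by split=> //; apply: (@le_trans _ _ 0); rewrite ?oppv_le0.
have e2 : 0 < e / 2 by lra.
have [[[u hu] N] hN] := oc I_dir x_cvg e2.
have /= := hN _ (directed_refl I_dir _); rewrite /x /= subr0 => uN.
have close n : (N <= n)%N -> q (a n - a N) < e / 2.
  move=> Nn; apply: le_lt_trans uN; apply: (seminorm_le hq).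
  by rewrite subv_ge0 a_le//= levD2rE.
exists N => m n Nm Nn; have := seminormB_le hq (a m) (a n) (a N).
by rewrite (seminormBC hq (a N)); have := close m Nm; have := close n Nn; lra.
Qed.

Lemma increasing_norm_cvg (a : nat -> F) (y : F) : (forall n, a n <= a n.+1) ->
  (forall n, a n <= y) ->
  exists l, [/\ norm_cvg q a l, forall n, a n <= l &
    forall u, (forall n, a n <= u) -> l <= u].
Proof.
move=> a_inc ay.
have [l al] := Banach_lattice_complete hB (increasing_Cauchy a_inc ay).
have a_le m n : (m <= n)%N -> a m <= a n.
  by move=> /subnK <-; elim: (n - m)%N => // k IHk; exact: le_trans IHk (a_inc _).
exists l; split=> [//|n|u au].
  apply: (@le_norm_limit (fun m => a (n + m)%N)) => [|m]; last first.
    by rewrite a_le// leq_addr.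
  apply/cvgn0P => e e0; have [N hN] := (cvgn0P _).1 al e e0.
  by exists N => m Nm; apply: hN; exact: leq_trans Nm (leq_addl _ _).
rewrite -levN2; apply: (@le_norm_limit (fun m => - a m)) => [|m]; last by rewrite levN2.
apply/cvgn0P => e e0; have [N hN] := (cvgn0P _).1 al e e0.
by exists N => m Nm; rewrite -opprD (seminormN hq); exact: hN.
Qed.

Lemma decreasing_norm_cvg (a : nat -> F) : (forall n, a n.+1 <= a n) ->
  (forall n, 0 <= a n) ->
  exists l, [/\ norm_cvg q a l, forall n, l <= a n & 0 <= l].
Proof.
move=> a_dec a0.
have [||l [al le_l l_le]] := @increasing_norm_cvg (fun n => - a n) 0.
- by move=> n; rewrite levN2.
- by move=> n; rewrite oppv_le0.
exists (- l); split=> [|n|]; last by rewrite oppv_ge0 l_le// => n; rewrite oppv_le0.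
  apply/cvgn0P => e e0; have [N hN] := (cvgn0P _).1 al e e0.
  by exists N => n Nn; rewrite opprK -(seminormN hq) opprD; exact: hN.
by rewrite -[_ <= _]levN2 opprK.
Qed.


(** The gliding hump of [almost_order_bounded] with the roles of elements and
    functionals exchanged. If no [g] works, there are [w n] in the interval such
    that the norm of [w n] exceeds [e] plus the value at [w n] of [2 ^+ n] times the
    sum of the norming functionals of the earlier terms. The suprema [v n] of the
    tails of [w] exist and decrease in norm to a limit at which all the norming
    functionals vanish, although the [n]th one exceeds [e] at [v n]. *)
Lemma seminorm_dominated (y : F) (e : R) : 0 <= y -> 0 < e ->
  exists (g : F -> R) (C : R), [/\ positive_functional g,
    forall x, 0 <= x -> g x <= C * q x &
    forall w, 0 <= w <= y -> q w <= g w + e].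
Proof.
move=> y0 e0; apply: contrapT => hno.
pose pb (g : F -> R) := positive_functional g /\
  exists C, forall x, 0 <= x -> g x <= C * q x.
have /choice[W hW] (g : F -> R) : exists w, pb g -> 0 <= w <= y /\ g w + e < q w.
  have [[hg [C gC]]|ng] := pselect (pb g); last by exists 0.
  apply: contrapT => hw; apply: hno; exists g, C; split=> // w wy.
  by rewrite leNgt; apply/negP => gw; apply: hw; exists w.
have /choice[nf hnf] (w : F) : exists f : F -> R, 0 <= w ->
    [/\ positive_functional f, forall x, 0 <= x -> f x <= q x & f w = q w].
  have [w0|nw] := pselect (0 <= w); last by exists (fun=> 0).
  by have [f hf] := norming_functional hq w0; exists f.
pose G := fix G n : F -> R := if n is m.+1
  then fun x => G m x + nf (W (fun x => 2 ^+ m * G m x)) x else fun=> 0.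
pose w n := W (fun x => 2 ^+ n * G n x); pose f n := nf (w n).
have pb_scale (c : R) g : 0 <= c -> pb g -> pb (fun x => c * g x).
  move=> c0 [hg [C gC]]; split.
    split=> [a x z|x x0]; first by rewrite (functional_linear hg); ring.
    by rewrite mulr_ge0// (functional_ge0 hg).
  by exists (c * C) => x x0; rewrite -mulrA ler_wpM2l ?gC.
have pbG n : pb (G n).
  elim: n => [|n IHn].
    split; last by exists 0 => x _; rewrite mul0r.
    by split=> // a x z; rewrite mulr0 addr0.
  have pow0 : 0 <= 2 ^+ n :> R by rewrite exprn_ge0.
  have [/andP[w0 _] _] := hW _ (pb_scale _ _ pow0 IHn).
  have [hf fq _] := hnf _ w0; have [hG [C GC]] := IHn; split.
    split=> [a x z|x x0] /=; last by rewrite addr_ge0 ?(functional_ge0 hG) ?(functional_ge0 hf).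
    by rewrite (functional_linear hG) (functional_linear hf); ring.
  by exists (C + 1) => x x0; rewrite mulrDl mul1r lerD ?GC ?fq.
have hw n : 0 <= w n <= y /\ 2 ^+ n * G n (w n) + e < q (w n).
  by apply: hW; apply: pb_scale => //; rewrite exprn_ge0.
have w0 n : 0 <= w n by have [/andP[]] := hw n.
have wy n : w n <= y by have [/andP[]] := hw n.
have hf n := hnf _ (w0 n).
have pf n : positive_functional (f n) by have [] := hf n.
have fq n x : 0 <= x -> f n x <= q x by have [_ + _] := hf n; apply.
have fw n : f n (w n) = q (w n) by have [] := hf n.
have G0 n x : 0 <= x -> 0 <= G n x by move=> x0; have [hG _] := pbG n; exact: functional_ge0.
have f_le_G k n x : (k < n)%N -> 0 <= x -> f k x <= G n x.
  move=> + x0; elim: n => // n IHn; rewrite ltnS leq_eqVlt => /predU1P[->|kn] /=.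
    by rewrite lerDr G0.
  by apply: le_trans (IHn kn) _; rewrite lerDl (functional_ge0 (pf n)).
have f_small k n : (k < n)%N -> f k (w n) <= q y * dyadic n.
  move=> kn; have qwy : q (w n) <= q y by apply: (seminorm_le hq); rewrite w0 wy.
  have [_ Gw] := hw n; have := f_le_G k n (w n) kn (w0 n).
  have pow0 : 0 < 2 ^+ n :> R by rewrite exprn_gt0.
  rewrite -(ler_pM2r pow0) -(ler_pM2r pow0 (f k (w n))) -mulrA dyadicK mulr1 mulrC.
  by move=> h; rewrite mulrC; nra.
have qw n : e < q (w n).
  have [_ Gw] := hw n; have : 0 <= 2 ^+ n * G n (w n) by rewrite mulr_ge0 ?exprn_ge0 ?G0.
  lra.
pose s n := fix s j : F := if j is l.+1 then vjoin (s l) (w (n + l).+1) else w n.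
have sy n j : s n j <= y by elim: j => //= j IHj; rewrite vjoin_le IHj wy.
have s_inc n j : s n j <= s n j.+1 by exact: vjoinl.
have s0 n j : 0 <= s n j.
  by elim: j => //= j IHj; exact: le_trans IHj (vjoinl _ _).
have s_shift n j : s n.+1 j <= s n j.+1.
  elim: j => /= [|j IHj]; first by rewrite addn0 vjoinr.
  by rewrite vjoin_le (le_trans IHj (vjoinl _ _)) -addSnnS vjoinr.
have f_s k n j : (k < n)%N -> f k (s n j) <= q y * \sum_(n <= l < (n + j).+1) dyadic l.
  move=> kn; elim: j => [|j IHj] /=.
    by rewrite addn0 big_nat1; exact: f_small.
  rewrite addnS big_nat_recr ?leqW ?leq_addr//= mulrDr.
  apply: le_trans (lerD IHj (f_small k (n + j).+1 _)); last first.
    by rewrite ltnS ltnW// (leq_trans kn)// leq_addr.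
  rewrite -(functionalD (pf k)); apply: (functional_le (pf k)).
  by rewrite vjoin_le -[X in X <= _]addr0 levD//= -[X in X <= _]add0r levD.
have /choice[v hv] n := increasing_norm_cvg (s_inc n) (sy n).
have sv n j : s n j <= v n by have [] := hv n.
have v0 n : 0 <= v n by exact: le_trans (s0 n 0%N) (sv n 0%N).
have v_dec n : v n.+1 <= v n.
  by have [_ _ h] := hv n.+1; apply: h => j; exact: le_trans (s_shift n j) (sv n _).
have [vl [v_cvg vl_le vl0]] := decreasing_norm_cvg v_dec v0.
have f_v k n : (k < n)%N -> f k (v n) <= q y * (2 * dyadic n).
  move=> kn; rewrite -[leRHS]addr0 -lerBlDl leNgt; apply/negP => d0.
  have [s_cvg _ _] := hv n; have [N /(_ N (leqnn N))] := (cvgn0P _).1 s_cvg _ d0.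
  rewrite ger0_norm ?seminorm_ge0// (seminormBC hq) => hN.
  have := fq k (v n - s n N); rewrite subv_ge0 sv => /(_ isT).
  rewrite (functionalB (pf k)) => hk.
  have := f_s k n N kn.
  have := ler_wpM2l (seminorm_ge0 hq y) (@dyadic_tail R n (n + N).+1).
  lra.
have f_vl k : f k vl <= 0.
  rewrite leNgt; apply/negP => f0; have [M hM] := dyadic_small (q y * 2) f0.
  pose n := maxn M k.+1; have := hM n (leq_maxl _ _); rewrite ltNge => /negP; apply.
  rewrite -mulrA; apply: le_trans (f_v k n (leq_maxr _ _)).
  exact: (functional_le (pf k)).
have [n /(_ n (leqnn n))] := (cvgn0P _).1 v_cvg e e0.
rewrite ger0_norm ?seminorm_ge0// => small.
have := fq n (v n - vl); rewrite subv_ge0 vl_le => /(_ isT).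
have := functional_le (pf n) (sv n 0%N); rewrite /= fw (functionalB (pf n)).
by have := f_vl n; have := qw n; lra.
Qed.

End OrderContinuousBanachLattices.

(** * Density of a pervasive space in its Dedekind completion *)

Section CompletionDensity.
Context {R : realType} {X : orderedLmodType R} {E : vectorLatticeType R}.
Context (i : {linear X -> E}).
Hypothesis hi : Dedekind_completion i.

Lemma embedding_ge0 x : (0 <= i x) = (0 <= x).
Proof. by apply/idP/idP => /(Dedekind_completion_bipositive hi). Qed.

Lemma embedding_le x y : (i x <= i y) = (x <= y).
Proof. by rewrite -[LHS]subv_ge0 -linearB embedding_ge0 subv_ge0. Qed.

(** If [y] had no majorant, order density would make it the infimum of the empty
    set, that is, the greatest element; then [y <= 0], and [0] is a majorant. *)
Lemma embedding_majorizing (y : E) : exists x, y <= i x.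
Proof.
apply: contrapT => hno.
have [_ /(_ (y + y))] := Dedekind_completion_dense hi y.
have hlb : lbound [set d | range i d /\ y <= d] (y + y).
  by move=> d [[x _ <-] yx]; case: hno; exists x.
move=> /(_ hlb); rewrite -[leRHS]addr0 levD2lE => y0.
by apply: hno; exists 0; rewrite linear0.
Qed.

Lemma embedding_dense_above (y z : E) :
  (forall x, y <= i x -> z <= i x) -> z <= y.
Proof.
move=> h; have [_] := Dedekind_completion_dense hi y; apply.
by move=> _ [[x _ <-] yx]; exact: h.
Qed.

Lemma embedding_dense_below (y z : E) :
  (forall x, i x <= y -> i x <= z) -> y <= z.
Proof.
move=> h; rewrite -levN2; apply: embedding_dense_above => x yx.
rewrite -[i x]opprK levN2 -linearN; apply: h.
by rewrite linearN -levN2 opprK.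
Qed.

(** Whether an element of [X] lies below the positive part of another one can be
    read off from the majorants of that positive part in [X], hence it does not
    depend on the completion. *)
Lemma pervasive_completion : pervasive X ->
  forall y : E, 0 < y -> exists x, 0 < i x <= y.
Proof.
move=> [Z [j [hj hperv]]] y y0.
have j_ge0 x : (0 <= j x) = (0 <= x).
  by apply/idP/idP => /(Riesz_completion_bipositive hj).
have j_le x x' : (j x <= j x') = (x <= x').
  by rewrite -[LHS]subv_ge0 -linearB j_ge0 subv_ge0.
have [d dy d0] : exists2 d, i d <= y & ~~ (i d <= 0).
  apply: contrapT => hno; suff : y <= 0 by rewrite (lt_geF y0).
  apply: embedding_dense_below => x xy; apply/negPn/negP => x0.
  by apply: hno; exists x.
have jd0 : 0 < vpos (j d).
  rewrite lt_def vpos_ge0 andbT; apply: contra d0 => /eqP vd.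
  have := vpos_ge (j d); rewrite vd -(linear0 j) j_le => d0.
  by rewrite -(linear0 i) embedding_le.
have [x /andP[x0 xd]] := hperv _ jd0; exists x; apply/andP; split.
  rewrite lt_neqAle embedding_ge0 -j_ge0 (ltW x0) andbT eq_sym.
  apply/eqP => ix0; have : x <= 0 by rewrite -embedding_le ix0 linear0.
  by rewrite -j_le linear0 (lt_geF x0).
apply: (@le_trans _ _ (vpos (i d))); last first.
  by rewrite vpos_le dy ltW.
apply: embedding_dense_above => u; rewrite vpos_le embedding_le embedding_ge0.
move=> /andP[du u0]; rewrite embedding_le -j_le; apply: le_trans xd _.
by rewrite vpos_le j_le du j_ge0.
Qed.

Hypotheses (hA : archimedean_space X) (hP : pervasive X).

(** A maximal directed set of positive elements below [y] has supremum [y]: if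
    [s < y] were its supremum, an element [x > 0] of [X] below [y - s] could be
    added to all of its members, again and again, against the Archimedean property. *)
Lemma directed_approximation (y : E) : 0 <= y -> exists D : set X,
  [/\ D !=set0, (forall x, D x -> 0 <= x /\ i x <= y),
    (forall a b, D a -> D b -> exists c, [/\ D c, a <= c & b <= c]) &
    forall z, (forall x, D x -> i x <= z) -> y <= z].
Proof.
move=> y0; pose P (D : set X) := (forall x, D x -> 0 <= x /\ i x <= y) /\
  (forall a b, D a -> D b -> exists c, [/\ D c, a <= c & b <= c]).
have [F FP Ftot|D [[Dy Ddir] Dmax]] := @Zorn_bigcup _ P.
  split=> [x [A FA Ax]|a b [A FA Aa] [B FB Bb]]; first by have [h _] := FP A FA; exact: h.
  have [AB|BA] := Ftot _ _ FA FB.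
    have [_ dB] := FP B FB; have [c [Bc ac bc]] := dB a b (AB _ Aa) Bb.
    by exists c; split=> //; exists B.
  have [_ dA] := FP A FA; have [c [Ac ac bc]] := dA a b Aa (BA _ Bb).
  by exists c; split=> //; exists A.
have sub D' : P D' -> D `<=` D' -> D' `<=` D.
  move=> PD' DD'; apply: contrapT => nD.
  by apply: (Dmax D') => //; rewrite properEneq; split=> // DE; apply: nD; rewrite DE.
have D0 : D !=set0.
  apply: contrapT => De; have P0 : P [set 0].
    split=> [x ->|a b -> ->]; first by rewrite linear0.
    by exists 0.
  have D_0 : D `<=` [set 0] by move=> x Dx; case: De; exists x.
  by apply: De; exists 0; exact: (sub _ P0 D_0).
exists D; split=> //.
have iD0 : [set i x | x in D] !=set0 by have [x Dx] := D0; exists (i x), x.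
have iDub : has_ubound [set i x | x in D].
  by exists y => _ [x Dx <-]; have [] := Dy x Dx.
have [s [s_ub s_lub]] := Dedekind_completion_complete hi iD0 iDub.
have sy : s <= y by apply: s_lub => _ [x Dx <-]; have [] := Dy x Dx.
have [<- z Dz|sny] := eqVneq s y; first by apply: s_lub => _ [x Dx <-]; exact: Dz.
have [|x /andP[x0 xys]] := pervasive_completion hP (y := y - s).
  by rewrite lt_def subv_ge0 sy subr_eq0 eq_sym sny.
have {}x0 : 0 <= x /\ ~~ (x <= 0).
  by split; [rewrite -embedding_ge0 ltW|rewrite -embedding_le linear0 (lt_geF x0)].
have [xge0 xn0] := x0.
pose D' : set X := [set z | D z \/ exists2 d, D d & z = d + x].
have D'_le z : D' z -> exists2 d, D d & z <= d + x.
  move=> [Dz|[d Dd ->]]; last by exists d.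
  by exists z => //; rewrite -[leLHS]addr0 levD2lE.
have PD' : P D'.
  split=> [z|a b /D'_le[a' Da aa'] /D'_le[b' Db bb']].
    move=> [/Dy //|[d Dd ->]]; have [d0 _] := Dy d Dd; split; first exact: addv_ge0.
    by rewrite linearD -levBrDr; apply: le_trans (s_ub _ _) _; [exists d|rewrite levBrDr -levBrDl].
  have [c [Dc ac bc]] := Ddir _ _ Da Db; exists (c + x).
  split; first by right; exists c.
    by apply: le_trans aa' _; rewrite levD2rE.
  by apply: le_trans bb' _; rewrite levD2rE.
have addx d : D d -> D (d + x).
  by move=> Dd; apply: (sub _ PD') => [z Dz|]; [left|right; exists d].
have [d Dd] := D0; have [u yu] := embedding_majorizing y.
case/negP: xn0; apply: (hA (y := u)) => n.
have Dn m : D (d + x *+ m).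
  by elim: m => [|m IHm]; rewrite ?addr0// mulrSr addrA; exact: addx.
have [_ dn] := Dy _ (Dn n.+1); have [d0 _] := Dy _ Dd.
rewrite -embedding_le; apply: le_trans yu; apply: le_trans dn.
by rewrite embedding_le -[leLHS]add0r levD2rE.
Qed.

End CompletionDensity.

Section DeltaNorm.
Context {R : realType} {X : orderedLmodType R} {E : vectorLatticeType R}.
Context (i : {linear X -> E}) (p : X -> R).
Hypotheses (hi : Dedekind_completion i) (hp : is_norm p) (hr : regular_norm p).

Let N := delta_norm p i.
Let majorants y := [set p x | x in [set x : X | - i x <= y <= i x]].

Let p0 : p 0 = 0.
Proof. by rewrite -(scale0r 0) (is_normZ hp) normr0 mul0r. Qed.

Let norm_ge0 x : 0 <= p x.
Proof.
have := is_normD hp x (- x); rewrite subrr p0 -scaleN1r (is_normZ hp) normrN1 mul1r.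
lra.
Qed.

Let majorants0 y : majorants y !=set0.
Proof.
have [x yx] := embedding_majorizing hi (labs y).
by exists (p x), x => //=; rewrite -labs_le.
Qed.

Let N_le y x : labs y <= i x -> N y <= p x.
Proof.
move=> yx; apply: ge_inf; first by exists 0 => _ [z _ <-]; exact: norm_ge0.
by exists x => //=; rewrite -labs_le.
Qed.

Let N_adherent y (e : R) : 0 < e -> exists2 x, labs y <= i x & p x < N y + e.
Proof.
move=> e0; have [|_ [x /= yx <-] xe] := inf_adherent (E := majorants y) e0.
  by split; [exact: majorants0|exists 0 => _ [z _ <-]; exact: norm_ge0].
by exists x; rewrite ?labs_le.
Qed.

Lemma delta_norm_seminorm : lattice_seminorm N.
Proof.
have NZ_le a y : a != 0 -> N (a *: y) <= `|a| * N y.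
  move=> a0; have ap : 0 < `|a| by rewrite normr_gt0.
  rewrite -ler_pdivrMl//; apply/ler_addgt0Pr => e e0.
  have [x yx xe] := N_adherent y e0; apply: le_trans (ltW xe).
  rewrite ler_pdivrMl// -[`|a|]normr_id -(is_normZ hp); apply: N_le.
  by rewrite labsZ linearZ lev_wpscale.
split=> [a y|x y|x y xy].
- have [->|a0] := eqVneq a 0.
    rewrite normr0 mul0r scale0r; apply: le_anti; apply/andP; split.
      rewrite -p0; apply: N_le.
      by rewrite linear0 labs_id.
    by apply: lb_le_inf; [exact: majorants0|move=> _ [z _ <-]; exact: norm_ge0].
  apply: le_anti; rewrite NZ_le//=.
  have := NZ_le a^-1 (a *: y); rewrite invr_eq0 => /(_ a0).
  by rewrite scalerA mulVf// scale1r normfV ler_pdivlMl ?normr_gt0.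
- apply/ler_addgt0Pr => e e0; have e2 : 0 < e / 2 by lra.
  have [u xu ue] := N_adherent x e2; have [v yv ve] := N_adherent y e2.
  apply: (@le_trans _ _ (p (u + v))).
    apply: N_le; rewrite linearD; apply: le_trans (labs_triangle _ _) _.
    exact: levD.
  by have := is_normD hp u v; lra.
- apply/ler_addgt0Pr => e e0; have [u yu ue] := N_adherent y e0.
  by apply: le_trans (ltW ue); apply: N_le; exact: le_trans yu.
Qed.

Lemma delta_norm_embedding x : N (i x) = p x.
Proof.
rewrite /N /delta_norm [RHS]hr; congr inf; apply/seteqP; split => _ [y /= yx <-];
  by exists y => //=; rewrite -linearN !(embedding_le hi) in yx *.
Qed.

Hypotheses (hA : archimedean_space X) (hP : pervasive X).
Hypothesis oc : order_continuous_norm p.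

(** Between [y] and a majorant [i u], the gaps [u - d' - d], where [d] approximates
    [y] and [d'] approximates [i u - y] from below, decrease to zero in [X]. *)
Lemma positive_approximation (y : E) (e : R) : 0 <= y -> 0 < e ->
  exists x, [/\ 0 <= x, i x <= y & N (y - i x) < e].
Proof.
move=> y0 e0; have [u yu] := embedding_majorizing hi y.
have uy0 : 0 <= i u - y by rewrite subv_ge0.
have [D [[d0 Dd0] Dy Ddir Dsup]] := directed_approximation hi hA hP y0.
have [D' [[d0' Dd0'] Dy' Ddir' Dsup']] := directed_approximation hi hA hP uy0.
pose I := ({d | D d} * {d | D' d})%type.
pose leI (a b : I) := sval a.1 <= sval b.1 /\ sval a.2 <= sval b.2.
pose gap (a : I) := u - sval a.2 - sval a.1.
have I_dir : directed leI.
  split=> [|a|a b c [ab1 ab2] [bc1 bc2]|[[a Da] [a' Da']] [[b Db] [b' Db']]].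
  - exact: (inhabits (exist _ d0 Dd0, exist _ d0' Dd0')).
  - by split.
  - by split; [exact: le_trans ab1 bc1|exact: le_trans ab2 bc2].
  have [c [Dc ac bc]] := Ddir _ _ Da Db; have [c' [Dc' ac' bc']] := Ddir' _ _ Da' Db'.
  by exists (exist _ c Dc, exist _ c' Dc').
have gap_dec a b : leI a b -> gap b <= gap a.
  by move=> [ab1 ab2]; rewrite !levD// levN2.
have gap_ge0 a : 0 <= gap a.
  rewrite /gap -addrA -opprD subv_ge0 -(embedding_le hi) linearD.
  have [_ ay] := Dy _ (svalP a.1); have [_ ay'] := Dy' _ (svalP a.2).
  by rewrite -[i u](subrK y) levD.
have gap_inf : infimums (range gap) 0.
  split=> [_ [a _ <-]|l hl]; first exact: gap_ge0.
  have il d d' : D d -> D' d' -> i l <= i u - i d' - i d.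
    move=> Dd Dd'; rewrite -!linearB (embedding_le hi).
    exact: (hl _ (imageT gap (exist _ d Dd, exist _ d' Dd'))).
  have il' d' : D' d' -> y <= i u - i d' - i l.
    move=> Dd'; apply: Dsup => d Dd; rewrite levBrDl -levBrDr.
    exact: il.
  have : i u - y <= i u - y - i l.
    apply: Dsup' => d' Dd'; rewrite addrAC levBrDl -levBrDr addrAC.
    exact: il'.
  by rewrite -[leLHS]addr0 levD2lE oppv_ge0 -(linear0 i) (embedding_le hi).
have gap_cvg : order_cvg leI gap 0.
  exists I, leI, gap; split=> // a; exists a => b ab; rewrite subr0 gap_dec//.
  by split=> //; apply: (@le_trans _ _ 0); rewrite ?oppv_le0.
have [[[d Dd] [d' Dd']] hd] := oc I_dir gap_cvg e0.
have /= := hd _ (directed_refl I_dir _); rewrite /gap /= subr0 => small.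
have [dge0 dy] := Dy _ Dd; have [_ dy'] := Dy' _ Dd'.
exists d; split=> //; apply: le_lt_trans small; apply: N_le.
rewrite labs_id ?subv_ge0// !linearB levD2rE.
by rewrite levBrDr addrC -levBrDr.
Qed.

Lemma dense_approximation (y : E) (e : R) : 0 < e -> exists x, N (y - i x) < e.
Proof.
move=> e0; have e2 : 0 < e / 2 by lra.
have [a [_ _ ha]] := positive_approximation (vpos_ge0 y) e2.
have [b [_ _ hb]] := positive_approximation (vpos_ge0 (- y)) e2.
exists (a - b).
have -> : y - i (a - b) = (vpos y - i a) + (i b - vpos (- y)).
  rewrite linearB {1}(vposBN y) opprB addrACA [RHS]addrACA.
  by congr (_ + _); exact: addrC.
have := seminormD delta_norm_seminorm (vpos y - i a) (i b - vpos (- y)).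
rewrite (seminormBC delta_norm_seminorm (i b)) => /le_lt_trans; apply.
by rewrite [e]splitr ltrD.
Qed.

End DeltaNorm.

(** * Extension of bounded operators by density *)

Section BoundedExtension.
Context {R : realType} {X : orderedLmodType R} {E Y : vectorLatticeType R}.
Context (i : {linear X -> E}) (N : E -> R) (q : Y -> R).
Hypotheses (hN : lattice_seminorm N) (hB : Banach_lattice q).
Hypothesis N_dense : forall (y : E) (e : R), 0 < e -> exists x, N (y - i x) < e.

Let hq := Banach_lattice_seminorm hB.

Lemma seminorm_limit_unique (l l' : Y) (C : R) :
  (forall e : R, 0 < e -> q (l - l') <= C * e) -> l = l'.
Proof.
move=> h; apply/eqP; rewrite -subr_eq0; apply/eqP.
apply: (is_norm_eq0 (Banach_lattice_norm hB)); apply: le_anti.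
rewrite seminorm_ge0// andbT; apply/ler_addgt0Pr => e e0; rewrite add0r.
have c0 : 0 < `|C| + 1 by rewrite ltr_wpDl.
apply: le_trans (h _ (divr_gt0 e0 c0)) _.
rewrite mulrA ler_pdivrMr// mulrC ler_wpM2l ?(ltW e0)//.
by have := ler_norm C; lra.
Qed.

Lemma bounded_extension (T : {linear X -> Y}) (C : R) : 0 <= C ->
  (forall x, q (T x) <= C * N (i x)) ->
  exists U : {linear E -> Y}, (forall x, U (i x) = T x) /\
    (forall y, q (U y) <= C * N y).
Proof.
move=> C0 TC.
have TB x x' : q (T x - T x') <= C * N (i x - i x') by rewrite -!linearB.
pose ext (y : E) (l : Y) := forall x, q (T x - l) <= C * N (i x - y).
(* [ext y l] determines [l] and holds for the limit of any approximating sequence. *)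
have ext_ex y : exists l, ext y l.
  have /choice[x hx] n : exists x, N (y - i x) < dyadic n by exact: N_dense (dyadic_gt0 n).
  have [e e0|l hl] := Banach_lattice_complete hB (u := T \o x).
    have [M hM] := dyadic_small (C * 2) e0.
    exists M => m n Mm Mn /=; apply: le_lt_trans (TB _ _) _.
    apply: le_lt_trans (hM M (leqnn M)); rewrite -mulrA ler_wpM2l//.
    apply: le_trans (seminormB_le hN _ _ y) _; rewrite (seminormBC hN _ y).
    have dec k : (M <= k)%N -> @dyadic R k <= dyadic M.
      by move=> Mk; rewrite ler_wiXn2l// ?invr_ge0//; lra.
    by have := hx m; have := hx n; have := dec _ Mm; have := dec _ Mn; lra.
  exists l => z; apply/ler_addgt0Pr => e e0.
  have e2 : 0 < e / 2 by lra.
  have [M hM] := dyadic_small C e2.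
  have [K hK] := (cvgn0P _).1 hl _ e2; pose n := maxn M K.
  have := hK n (leq_maxr _ _); rewrite ger0_norm ?seminorm_ge0//= => h1.
  have h2 := hM n (leq_maxl _ _).
  have := seminormB_le hq (T z) l (T (x n)).
  have := TB z (x n).
  have := ler_wpM2l C0 (seminormB_le hN (i z) (i (x n)) y).
  by have := ler_wpM2l C0 (ltW (hx n)); rewrite mulrDr; lra.
have /choice[U hU] := ext_ex.
have ext_unique y l l' : ext y l -> ext y l' -> l = l'.
  move=> hl hl'; apply: (@seminorm_limit_unique _ _ (2 * C)) => e e0.
  have [x hx] := N_dense y e0; rewrite (seminormBC hN) in hx.
  have := seminormB_le hq l l' (T x); rewrite (seminormBC hq l (T x)).
  have := hl x; have := hl' x; have := ler_wpM2l C0 (ltW hx); lra.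
have Ulin : linear U.
  move=> a y y'; apply: (@seminorm_limit_unique _ _ (2 * C * (`|a| + 1))) => e e0.
  have [x hx] := N_dense y e0; rewrite (seminormBC hN) in hx.
  have [x' hx'] := N_dense y' e0; rewrite (seminormBC hN) in hx'.
  have h0 := hU (a *: y + y') (a *: x + x').
  have := seminormB_le hq (U (a *: y + y')) (a *: U y + U y') (T (a *: x + x')).
  rewrite (seminormBC hq (U _) (T _)) {2}linearP.
  have -> : a *: T x + T x' - (a *: U y + U y') = a *: (T x - U y) + (T x' - U y').
    by rewrite opprD addrACA -scalerBr.
  have := seminormD hq (a *: (T x - U y)) (T x' - U y'); rewrite (seminormZ hq).
  have hxx : N (i (a *: x + x') - (a *: y + y')) <= `|a| * e + e.
    have -> : i (a *: x + x') - (a *: y + y') = a *: (i x - y) + (i x' - y').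
      by rewrite linearP opprD addrACA -scalerBr.
    apply: le_trans (seminormD hN _ _) _; rewrite (seminormZ hN).
    by apply: lerD; [rewrite ler_wpM2l// ltW|exact: ltW].
  have := ler_wpM2l C0 hxx; have := ler_wpM2l C0 (ltW hx').
  have := ler_wpM2l (normr_ge0 a) (ler_wpM2l C0 (ltW hx)).
  have := ler_wpM2l (normr_ge0 a) (hU y x); have := hU y' x'.
  lra.
pose V : {linear E -> Y} := HB.pack U (GRing.isLinear.Build R E Y _ U Ulin).
exists V; split=> [x|y].
  apply: (ext_unique (i x)); first exact: hU.
  by move=> x'; exact: TB.
have := hU y 0; rewrite linear0 !sub0r !(seminormN hq) linear0 sub0r (seminormN hN).
exact.
Qed.

Lemma extension_totally_bounded (U : {linear E -> Y}) (C : R) : 0 <= C ->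
  (forall y, q (U y) <= C * N y) ->
  (forall M, totally_bounded [set x | N (i x) <= M]
    (fun x x' => q (U (i x) - U (i x')))) ->
  forall M, totally_bounded [set z | N z <= M] (fun z z' => q (U z - U z')).
Proof.
move=> C0 UC tb M e e0; pose d : R := e / (4 * (C + 1)).
have c0 : 0 < 4 * (C + 1) by lra.
have d0 : 0 < d by rewrite divr_gt0.
have Cd : C * d <= e / 4.
  by rewrite /d mulrA ler_pdivrMr//; have := ltW e0; nra.
have e2 : 0 < e / 2 by lra.
have /choice[x hx] z : exists x, N (z - i x) < d by exact: N_dense.
have [I [c hc]] := tb (M + d) _ e2.
exists I, (c \o x) => z z' zM zM' cE.
have xM w : N w <= M -> N (i (x w)) <= M + d.
  move=> wM; have := seminormB_le hN (i (x w)) 0 w.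
  by rewrite !subr0 (seminormBC hN _ w); have := hx w; lra.
have := hc _ _ (xM _ zM) (xM _ zM') cE.
have UB w : q (U w - U (i (x w))) <= e / 4.
  rewrite -linearB; apply: le_trans (UC _) _; apply: le_trans Cd.
  by rewrite ler_wpM2l// ltW.
have := seminormB_le hq (U z) (U z') (U (i (x z))).
have := seminormB_le hq (U (i (x z))) (U z') (U (i (x z'))).
rewrite (seminormBC hq (U (i (x z'))) (U z')); have := UB z; have := UB z'; lra.
Qed.

Hypothesis N_pos_dense : forall (y : E) (e : R), 0 <= y -> 0 < e ->
  exists x, [/\ 0 <= x, i x <= y & N (y - i x) < e].

(** Positivity is known on the image of the positive cone of [X] only, which is why
    the approximants of a positive element have to be positive. *)
Lemma extension_ge0 (U : {linear E -> Y}) (C : R) : 0 <= C ->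
  (forall y, q (U y) <= C * N y) -> (forall x, 0 <= x -> 0 <= U (i x)) ->
  forall y, 0 <= y -> 0 <= U y.
Proof.
move=> C0 UC U0 y y0.
have /choice[x hx] n : exists x, 0 <= x /\ N (y - i x) < dyadic n.
  by have [x [x0 _ xn]] := N_pos_dense y0 (dyadic_gt0 n); exists x.
apply: (@le_norm_limit _ _ _ hB (fun n => U (i (x n)))) => [|n]; last first.
  by apply: U0; have [] := hx n.
apply/cvgn0P => e e0; have [M hM] := dyadic_small C e0.
exists M => n Mn; rewrite ger0_norm ?seminorm_ge0//.
apply: le_lt_trans (hM n Mn); rewrite -linearB; apply: le_trans (UC _) _.
by rewrite ler_wpM2l// (seminormBC hN) ltW//; have [] := hx n.
Qed.

End BoundedExtension.

(** * Compact maps and total boundedness *)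

Section CompactMaps.
Context {R : realType} {U : lmodType R} {W : vectorLatticeType R}.
Context (p : U -> R) (q : W -> R) (f : {linear U -> W}).
Hypothesis hB : Banach_lattice q.

Let hq := Banach_lattice_seminorm hB.

(** Without a colouring of mesh [e], no finite set is an [e / 2]-net of the image, so
    that an [e / 2]-separated sequence can be chosen term by term. *)
Lemma compact_map_totally_bounded (M : R) : compact_map p q f ->
  totally_bounded [set u | p u <= M] (fun u v => q (f u - f v)).
Proof.
move=> cf e e0; apply: contrapT => hno.
have e2 : 0 < e / 2 by lra.
have /choice[nxt hnxt] (s : seq U) : exists u,
    p u <= M /\ forall v, v \in s -> e / 2 <= q (f u - f v).
  apply: contrapT => hs; apply: hno.
  pose near_ u v := q (f u - f v) < e / 2.
  have near_s u : p u <= M -> (find (near_ u) s < size s)%N.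
    move=> uM; rewrite -has_find; apply/hasPn => hn; apply: hs; exists u; split=> // v vs.
    by rewrite leNgt hn.
  exists 'I_(size s).+1, (fun u => inord (find (near_ u) s)) => u v uM vM cE.
  have fE : find (near_ u) s = find (near_ v) s.
    by move/(congr1 val): cE; rewrite /= !inordK// ltnS find_size.
  pose w := nth 0 s (find (near_ u) s).
  have uw : near_ u w by apply: nth_find; rewrite has_find near_s.
  have vw : near_ v w by rewrite /w fE; apply: nth_find; rewrite has_find near_s.
  have := seminormB_le hq (f u) (f v) (f w); rewrite (seminormBC hq (f w)).
  by rewrite /near_ in uw vw; lra.
pose L := fix L n : seq U := if n is m.+1 then nxt (L m) :: L m else [::].
pose u n := nxt (L n).
have uL m n : (m < n)%N -> u m \in L n.
  elim: n => // n IHn; rewrite ltnS leq_eqVlt in_cons => /predU1P[->|/IHn ->].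
    by rewrite eqxx.
  by rewrite orbT.
have [|phi [phi_inc [l hl]]] := cf u.
  by exists M => n; have [] := hnxt (L n).
have e4 : 0 < e / 4 by lra.
have [N hN] := (cvgn0P _).1 hl _ e4.
have := hN N (leqnn N); have := hN N.+1 (leqnSn N).
rewrite !ger0_norm ?seminorm_ge0// => h1 h0.
have [_ /(_ _ (uL _ _ (phi_inc N N.+1 (ltnSn N))))] := hnxt (L (phi N.+1)).
have := seminormB_le hq (f (u (phi N.+1))) (f (u (phi N))) l.
rewrite (seminormBC hq l) -/(u _); lra.
Qed.

Lemma unbounded_color (I : finType) (c : nat -> I) (A : set nat) :
  (forall m, exists n, (m <= n)%N /\ A n) ->
  exists i, forall m, exists n, [/\ (m <= n)%N, A n & c n = i].
Proof.
move=> Aunb; apply: contrapT => hno.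
have /choice[b hb] i : exists m, forall n, (m <= n)%N -> A n -> c n <> i.
  apply: contrapT => hi; apply: hno; exists i => m; apply: contrapT => hm.
  by apply: hi; exists m => n mn An cn; apply: hm; exists n.
have [n [bn An]] := Aunb (\max_i b i).
by apply: (hb (c n) n) => //; apply: leq_trans bn; exact: leq_bigmax.
Qed.

(** Repeated use of the pigeonhole principle for the colourings of mesh [2 ^- k]
    gives a decreasing sequence of infinite sets of indices; a diagonal subsequence
    is Cauchy. *)
Lemma totally_bounded_compact_map :
  (forall M, totally_bounded [set u | p u <= M] (fun u v => q (f u - f v))) ->
  compact_map p q f.
Proof.
move=> tb u [M uM]; pose unb (A : set nat) := forall m, exists n, (m <= n)%N /\ A n.
have /choice[st hst] (kA : nat * set nat) : exists B, unb kA.2 ->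
    [/\ unb B, B `<=` kA.2 &
      forall m n, B m -> B n -> q (f (u m) - f (u n)) < dyadic kA.1].
  case: kA => k A; have [Au|nA] := pselect (unb A); last by exists A.
  have [I [c hc]] := tb M _ (dyadic_gt0 k).
  have [i hi] := unbounded_color (fun n => c (u n)) Au.
  exists [set n | A n /\ c (u n) = i] => _; split=> [m|n []//|m n [_ cm] [_ cn]].
    by have [n [mn An cn]] := hi m; exists n.
  by apply: hc; rewrite /= ?cm ?cn.
have /choice[pk hpk] (Am : set nat * nat) : exists n, unb Am.1 -> (Am.2 <= n)%N /\ Am.1 n.
  have [Au|nA] := pselect (unb Am.1); last by exists 0%N.
  by have [n hn] := Au Am.2; exists n.
pose B := fix B k : set nat := if k is l.+1 then st (l, B l) else setT.
have Bunb k : unb (B k).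
  by elim: k => [m|k IHk]; [exists m|have [] := hst (k, B k) IHk].
have B_sub k l : (k <= l)%N -> B l `<=` B k.
  move=> /subnK <-; elim: (l - k)%N => // j IHj.
  by apply: subset_trans IHj; have [_ + _] := hst (j + k, B (j + k))%N (Bunb _).
pose phi := fix phi k : nat :=
  if k is l.+1 then pk (B k.+1, (phi l).+1) else pk (B 1%N, 0%N).
have phiB k : B k.+1 (phi k).
  by case: k => [|k]; [have [] := hpk (B 1%N, 0%N) (Bunb _)|
    have [] := hpk (B k.+2, (phi k).+1) (Bunb _)].
have phi_inc : {homo phi : m n / (m < n)%N}.
  apply: homo_ltn => [m n k|k]; first exact: ltn_trans.
  by have [] := hpk (B k.+2, (phi k).+1) (Bunb _).
exists phi; split=> //.
have [|l hl] := Banach_lattice_complete hB (u := fun n => f (u (phi n))); last by exists l.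
move=> e e0; have [K hK] := dyadic_small 1 e0.
exists K => m n Km Kn; have := hK K (leqnn K); rewrite mul1r; apply: lt_trans.
have [_ _ /(_ (phi m) (phi n))] := hst (K, B K) (Bunb K); apply.
  exact: (B_sub K.+1 m.+1 Km) (phiB m).
exact: (B_sub K.+1 n.+1 Kn) (phiB n).
Qed.

End CompactMaps.

(** * The Dodds-Fremlin theorem *)

Section DoddsFremlin.
Context {R : realType} {E F : vectorLatticeType R} (N : E -> R) (q : F -> R).
Context (S T : {linear E -> F}) (C : R).
Hypotheses (hN : lattice_seminorm N) (hB : Banach_lattice q).
Hypotheses (ocN : order_continuous_norm (dual_norm N)) (ocq : order_continuous_norm q).
Hypotheses (S_ge0 : forall z, 0 <= z -> 0 <= S z)
  (S_le : forall z, 0 <= z -> S z <= T z) (TC : forall z, q (T z) <= C * N z).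
Hypothesis T_tb :
  forall M, totally_bounded [set z | N z <= M] (fun z z' => q (T z - T z')).

Let hq := Banach_lattice_seminorm hB.

Let T_ge0 z : 0 <= z -> 0 <= T z.
Proof. by move=> z0; exact: le_trans (S_ge0 z0) (S_le z0). Qed.

Lemma functional_le_seminorm (f : F -> R) : positive_functional f ->
  (forall y, 0 <= y -> f y <= q y) -> forall y, f y <= q y.
Proof.
move=> hf fq y; apply: le_trans (ler_norm _) _; apply: le_trans (functional_norm hf y) _.
by rewrite -(seminorm_labs hq) fq// labs_ge0.
Qed.

(** On a finite net of the image of the positive unit ball, the norm is attained by
    norming functionals; [g] is their sum. *)
Lemma image_of_ball_dominated (e : R) : 0 < e ->
  exists (g : F -> R) (D : R), [/\ positive_functional g, 0 <= D,
    forall y, 0 <= y -> g y <= D * q y &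
    forall z, 0 <= z -> N z <= 1 -> q (T z) <= g (T z) + e].
Proof.
move=> e0; have e2 : 0 < e / 2 by lra.
have [I [c hc]] := T_tb 1 e2.
have /choice[f hf] (i : I) : exists f : F -> R, [/\ positive_functional f,
    forall y, 0 <= y -> f y <= q y &
    forall z, 0 <= z -> N z <= 1 -> c z = i -> q (T z) <= f (T z) + e].
  have [[z [z0 z1 cz]]|hno] := pselect (exists z, [/\ 0 <= z, N z <= 1 & c z = i]); last first.
    exists (fun=> 0); split=> [|y y0|z z0 z1 cz].
    - by split=> // a x y; rewrite mulr0 addr0.
    - exact: seminorm_ge0.
    - by case: hno; exists z.
  have [f [hf fq fz]] := norming_functional hq (T_ge0 z0).
  exists f; split=> // z' z'0 z'1 cz'.
  have close : q (T z - T z') < e / 2 by apply: hc => //; rewrite cz.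
  have := functional_le_seminorm hf fq (T z - T z').
  rewrite (functionalB hf) fz.
  have := seminormB_le hq (T z') 0 (T z); rewrite !subr0 (seminormBC hq (T z')).
  lra.
have f0 i y : 0 <= y -> 0 <= f i y by move=> y0; have [h _ _] := hf i; exact: functional_ge0.
exists (fun y => \sum_i f i y), #|I|%:R; split=> // [|y y0|z z0 z1].
- split=> [a x y|y y0]; last by apply: sumr_ge0 => i _; exact: f0.
  rewrite mulr_sumr -big_split; apply: eq_bigr => i _ /=.
  by have [h _ _] := hf i; exact: functional_linear.
- rewrite mulr_natl -sumr_const; apply: ler_sum => i _.
  by have [_ h _] := hf i; exact: h.
- have [_ _ /(_ z z0 z1 erefl)] := hf (c z); move=> /le_trans; apply.
  rewrite lerD2r (bigD1 (c z))//= lerDl; apply: sumr_ge0 => i _.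
  by rewrite f0// T_ge0.
Qed.

(** The differences of the images under [S] stay between [- T x] and [T x], where a
    single functional controls the norm. *)
Lemma dominated_interval_totally_bounded (x : E) : 0 <= x ->
  totally_bounded [set z | 0 <= z <= x] (fun z z' => q (S z - S z')).
Proof.
move=> x0 e e0; have e2 : 0 < e / 2 by lra.
have [g [D [hg gD gq]]] := seminorm_dominated hB ocq (T_ge0 x0) e2.
have d0 : 0 < `|D| + 1 by rewrite ltr_wpDl.
have [|I [c hc]] := dominated_interval S_ge0 S_le hg x0 _ e2.
  move=> d dp; have [I [c hc]] := T_tb (N x) (divr_gt0 dp d0).
  exists I, c => z z' zx zx' cE.
  have zN w : 0 <= w <= x -> N w <= N x by exact: (seminorm_le hN).
  have := hc z z' (zN _ zx) (zN _ zx') cE; rewrite ltr_pdivlMr// => h.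
  apply: le_lt_trans h; apply: le_trans (gD _ (labs_ge0 _)) _.
  rewrite (seminorm_labs hq) mulrC ler_wpM2l ?seminorm_ge0//.
  by have := ler_norm D; lra.
exists I, c => z z' zx zx' cE; have := hc z z' zx zx' cE.
have S_mono u v : u <= v -> S u <= S v.
  by rewrite -subv_ge0 => /S_ge0; rewrite linearB subv_ge0.
have S_le_Tx u v : 0 <= u <= x -> 0 <= v <= x -> S u - S v <= T x.
  move=> /andP[_ ux] /andP[v0 _]; rewrite levBlDr -[leLHS]addr0 levD ?S_ge0//.
  by apply: le_trans (S_mono _ _ ux) _; exact: S_le.
have := gq (labs (S z - S z')); rewrite labs_ge0 vjoin_le opprB !S_le_Tx//.
by move=> /(_ isT); rewrite (seminorm_labs hq); lra.
Qed.

(** The Dodds-Fremlin theorem, with total boundedness in place of compactness, as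
    [E] need not be complete. Up to a small error a positive [z] in the unit ball may
    be replaced by [vmeet z x], for one and the same [x]. *)
Theorem Dodds_Fremlin (M : R) :
  totally_bounded [set z | N z <= M] (fun z z' => q (S z - S z')).
Proof.
suff unit_ball : totally_bounded [set z | N z <= 1] (fun z z' => q (S z - S z')).
  move=> e e0; pose r : R := `|M| + 1; have r0 : 0 < r by rewrite ltr_wpDl.
  have [I [c hc]] := unit_ball _ (divr_gt0 e0 r0).
  exists I, (fun z => c (r^-1 *: z)) => z z' zM zM' cE.
  have ball w : N w <= M -> N (r^-1 *: w) <= 1.
    move=> wM; rewrite (seminormZ hN) gtr0_norm ?invr_gt0// ler_pdivrMl// mulr1.
    by apply: le_trans wM _; have := ler_norm M; rewrite /r; lra.
  have := hc _ _ (ball _ zM) (ball _ zM') cE.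
  have -> : S (r^-1 *: z) - S (r^-1 *: z') = r^-1 *: (S z - S z').
    by rewrite scalerBr !linearZZ.
  rewrite (seminormZ hq) gtr0_norm ?invr_gt0// ltr_pdivlMr// mulrAC.
  by rewrite mulVf ?gt_eqF// mul1r.
move=> e e0; pose d := e / 16; have d0 : 0 < d by rewrite divr_gt0.
have [g [D [hg D0 gD gT]]] := image_of_ball_dominated d0.
have [|z z0||x x0 hx] :=
    @almost_order_bounded _ _ N hN ocN (fun z => g (T z)) (D * C) d.
- split=> [a z z'|z z0]; first by rewrite linearP (functional_linear hg).
  by rewrite (functional_ge0 hg) ?T_ge0.
- by apply: le_trans (gD _ (T_ge0 z0)) _; rewrite -mulrA ler_wpM2l.
- exact: d0.
have excess w : 0 <= w -> N w <= 1 -> q (S (vpos (w - x))) <= d + d.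
  move=> w0 w1; have p0 := vpos_ge0 (w - x).
  have pN : N (vpos (w - x)) <= 1.
    apply: le_trans w1; apply: (seminorm_le hN); rewrite p0 vpos_le w0 andbT.
    by rewrite levBlDr -[leLHS]addr0 levD2lE.
  apply: (@le_trans _ _ (q (T (vpos (w - x))))).
    by apply: (seminorm_le hq); rewrite S_ge0// S_le.
  by apply: le_trans (gT _ p0 pN) _; rewrite lerD2r hx.
have [I [c hc]] := dominated_interval_totally_bounded x0 d0.
have positive_part w w' : 0 <= w -> N w <= 1 -> 0 <= w' -> N w' <= 1 ->
    c (vmeet w x) = c (vmeet w' x) -> q (S w - S w') < 5 * d.
  move=> w0 w1 w'0 w'1 cE.
  have SE u : S u = S (vmeet u x) + S (vpos (u - x)).
    by rewrite -linearD -vmeetB addrC subrK.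
  have meet_x u : 0 <= u -> 0 <= vmeet u x <= x by move=> u0; rewrite le_vmeet u0 x0 vmeetr.
  rewrite (SE w) (SE w') opprD addrACA.
  have := hc _ _ (meet_x _ w0) (meet_x _ w'0) cE.
  have := seminormD hq (S (vmeet w x) - S (vmeet w' x))
    (S (vpos (w - x)) - S (vpos (w' - x))).
  have := seminormD hq (S (vpos (w - x))) (- S (vpos (w' - x))).
  rewrite (seminormN hq); have := excess _ w0 w1; have := excess _ w'0 w'1; lra.
exists (I * I)%type, (fun z => (c (vmeet (vpos z) x), c (vmeet (vpos (- z)) x))).
move=> z z' z1 z'1 [c1 c2].
have pN w : N w <= 1 -> N (vpos w) <= 1 by exact: le_trans (seminorm_vpos hN w).
have nN w : N w <= 1 -> N (vpos (- w)) <= 1.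
  by move=> w1; rewrite pN// (seminormN hN).
have h1 := positive_part _ _ (vpos_ge0 _) (pN _ z1) (vpos_ge0 _) (pN _ z'1) c1.
have h2 := positive_part _ _ (vpos_ge0 _) (nN _ z1) (vpos_ge0 _) (nN _ z'1) c2.
have -> : S z - S z' = (S (vpos z) - S (vpos z')) - (S (vpos (- z)) - S (vpos (- z'))).
  have SE u : S u = S (vpos u) - S (vpos (- u)) by rewrite -linearB -vposBN.
  rewrite (SE z) (SE z') !opprB addrACA [RHS]addrACA.
  by congr (_ + _); exact: addrC.
have := seminormD hq (S (vpos z) - S (vpos z')) (- (S (vpos (- z)) - S (vpos (- z')))).
by rewrite (seminormN hq); rewrite /d in h1 h2; lra.
Qed.

End DoddsFremlin.

(** * Domination of compact operators on pervasive spaces *)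

Theorem theorem5p4 (R : realType)
  (X : orderedLmodType R) (normX : X -> R)
  (Xd : vectorLatticeType R) (i : {linear X -> Xd})
  (Y : vectorLatticeType R) (normY : Y -> R)
  (T S : {linear X -> Y}) :
  archimedean_space X -> pre_Riesz X -> pervasive X ->
  is_norm normX -> regular_norm normX -> order_continuous_norm normX ->
  Dedekind_completion i ->
  Banach_lattice normY -> order_continuous_norm normY ->
  bounded_map normX normY T -> positive_operator T ->
  compact_map normX normY T ->
  order_continuous_norm (dual_norm (delta_norm normX i)) ->
  bounded_map normX normY S -> positive_operator S -> op_le S T ->
  compact_map normX normY S.
Proof.
move=> hA _ hP hnX hrX ocX hi hB ocY [CT hCT] T_pos cT ocd [CS hCS] S_pos ST.
pose N := delta_norm normX i.
have hN : lattice_seminorm N := delta_norm_seminorm hi hnX.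
have hq := Banach_lattice_seminorm hB.
have Ni x : N (i x) = normX x by exact: delta_norm_embedding.
have dense := dense_approximation hi hnX hA hP ocX.
have pos_dense := positive_approximation hi hnX hA hP ocX.
have bound (U : {linear X -> Y}) C : (forall x, normY (U x) <= C * normX x) ->
    forall x, normY (U x) <= `|C| * N (i x).
  move=> hU x; apply: le_trans (hU x) _.
  by rewrite Ni ler_wpM2r ?ler_norm// -Ni seminorm_ge0.
have [T' [T'i T'C]] := bounded_extension hN hB dense (normr_ge0 CT) (bound _ _ hCT).
have [S' [S'i S'C]] := bounded_extension hN hB dense (normr_ge0 CS) (bound _ _ hCS).
have S'_ge0 : forall y, 0 <= y -> 0 <= S' y.
  apply: (extension_ge0 hN hB pos_dense (normr_ge0 CS) S'C) => x x0.
  by rewrite S'i; exact: S_pos.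
have S'_le y : 0 <= y -> S' y <= T' y.
  move=> y0; pose D : {linear Xd -> Y} := T' \- S'.
  rewrite -subv_ge0; have C0 : 0 <= `|CT| + `|CS| by rewrite addr_ge0.
  apply: (extension_ge0 hN hB pos_dense C0 (U := D)) => // [z|x x0].
    rewrite mulrDl; apply: le_trans (seminormD hq _ _) _.
    by rewrite (seminormN hq); apply: lerD.
  by rewrite /D /= T'i S'i subv_ge0; exact: ST.
have T'_tb : forall M, totally_bounded [set z | N z <= M]
    (fun z z' => normY (T' z - T' z')).
  apply: (extension_totally_bounded hN hB dense (normr_ge0 CT) T'C) => M e e0.
  have [I [c hc]] := compact_map_totally_bounded hB M cT e0.
  by exists I, c => x x' /=; rewrite !Ni !T'i; exact: hc.
apply: (totally_bounded_compact_map hB) => M e e0.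
have [I [c hc]] := Dodds_Fremlin hN hB ocd ocY S'_ge0 S'_le T'C T'_tb M e0.
exists I, (c \o i) => x x' xM x'M cE; rewrite -!S'i; apply: hc => //=.
  by rewrite Ni.
by rewrite Ni.
Qed.
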